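(* Let $B^H$ be a fractional Brownian motion with Hurst index $H\in(0,1)$. Then almost surely, for every continuous and bounded $\varphi:\mathbb R\to\mathbb R$, $$\frac1{\log n}\sum_{k=1}^{n}\frac1k\,\varphi\big(B^H_k/k^H\big)\longrightarrow E[\varphi(N)]\quad\text{as }n\to\infty,$$ where $N\sim\mathscr N(0,1)$.
   Context: A fractional Brownian motion with Hurst index $H\in(0,1)$ is a centered Gaussian process $(B^H_t)_{t\ge0}$ with continuous paths and covariance $E[B^H_tB^H_s]=\frac12(t^{2H}+s^{2H}-|t-s|^{2H})$. *)

(* Defs.v *)
From HB Require Import structures.
From mathcomp Require Import all_boot all_order all_algebra.
From mathcomp Require Import all_classical all_reals all_analysis.
Set Implicit Arguments. Unset Strict Implicit. Unset Printing Implicit Defensive.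
Import Order.TTheory GRing.Theory Num.Theory.
Import numFieldNormedType.Exports.
Local Open Scope classical_set_scope.
Local Open Scope ring_scope.

Definition is_gaussian_rv {d : measure_display} {T : measurableType d}
  {R : realType} (P : probability T R) (X : T -> R) : Prop :=
  measurable_fun setT X /\
  exists m s : R,
    (s = 0 /\ P [set w | X w = m] = 1%E) \/
    (0 < s /\ forall A : set R, measurable A ->
        P (X @^-1` A) = normal_prob m s A).

Definition is_fBm {d : measure_display} {T : measurableType d}
  {R : realType} (P : probability T R) (H : R) (B : R -> T -> R) : Prop :=
  [/\ (forall (n : nat) (t : 'I_n -> R) (a : 'I_n -> R),
         (forall i, 0 <= t i) ->
         is_gaussian_rv P (fun w => \sum_(i < n) a i * B (t i) w)),
      (forall t, 0 <= t -> ('E_P[B t] = 0)%E),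
      (forall t s, 0 <= t -> 0 <= s ->
         ('E_P[B t \* B s] =
           ((t `^ (2 * H) + s `^ (2 * H) - `|t - s| `^ (2 * H)) / 2)%:E)%E)
    & (forall w, {within `[0, +oo[, continuous (fun t => B t w)})].

(* Main.v *)
(** Put [X_k = B_k / k^H], a standard Gaussian variable.  For [j <= k] the
    correlation of [X_j] and [X_k] lies between [0] and [2 (j/k)^b] with
    [b = min(H, 1 - H)], so the covariances of the variables [exp(c X_k)],
    explicit from the Gaussian moment generating function, are
    [O((j/k)^b)], and the variance of the logarithmic mean of [exp(c X_k)] up to
    [n] is [O(1 / ln n)].  This is summable along [n = 2^(m^2)], which gives
    almost sure convergence there; positivity of the summands extends it to
    all [n].

    Hence almost surely the logarithmic means of [exp(q x)] converge to the
    Gaussian integral for all rational [q].  For such a fixed path, the class of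
    functions whose logarithmic means converge to the Gaussian integral is
    closed under limits in the norms weighted by [exp(c |x|)].  Finite
    differences of exponentials put the polynomials in it, and Taylor expansion
    the functions [cos(a x + b)].  Polynomials in [cos(a x + b)] stay bounded
    on the whole line, so a bounded continuous function, approximated on a large
    interval by Bernstein polynomials in such a cosine, belongs to it as well. *)

Require Import Defs.
From HB Require Import structures.
From mathcomp Require Import all_boot all_order all_algebra.
From mathcomp Require Import all_classical all_reals all_analysis.
From mathcomp Require Import measurable_realfun ring lra.
Set Implicit Arguments. Unset Strict Implicit. Unset Printing Implicit Defensive.
Import Order.TTheory GRing.Theory Num.Theory.
Import numFieldNormedType.Exports.
Local Open Scope classical_set_scope.
Local Open Scope ring_scope.

(** * The Gaussian moment generating function *)

(** [normal_pdf] and the Radon-Nikodym derivative of [normal_prob] have equal integrals over every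
    measurable set, hence agree almost everywhere. *)
Lemma ge0_integral_normal_prob (R : realType) (m s : R) (f : R -> R) :
  measurable_fun setT f -> (forall x, 0 <= f x) ->
  (\int[normal_prob m s]_x (f x)%:E =
   \int[lebesgue_measure]_x (f x * normal_pdf m s x)%:E)%E.
Proof.
move=> mf f0.
rewrite -(Radon_Nikodym_SigmaFinite.change_of_variables
  (normal_prob_dominates m s)) //=; last exact/measurable_EFinP.
under [RHS]eq_integral do rewrite EFinM.
have imu : (@lebesgue_measure R).-integrable setT
  (Radon_Nikodym_SigmaFinite.f (normal_prob m s) lebesgue_measure).
  exact/Radon_Nikodym_SigmaFinite.f_integrable/normal_prob_dominates.
apply: ae_eq_integral => //.
- apply: emeasurable_funM; first exact/measurable_EFinP.
  exact: measurable_int imu.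
- apply: emeasurable_funM; first exact/measurable_EFinP.
  by apply/measurable_EFinP; exact: measurable_normal_pdf.
- apply: ae_eqe_mul2l; apply: integral_ae_eq => //.
  + by apply/measurable_EFinP; exact: measurable_normal_pdf.
  + move=> E _ mE.
    by rewrite -Radon_Nikodym_SigmaFinite.f_integral//;
      exact: normal_prob_dominates.
Qed.

(** Completing the square: tilting the density by [expR (t * x)] gives a constant times the density
    with mean [m + t * s ^+ 2]. *)
Lemma normal_mgf (R : realType) (m s t : R) : s != 0 ->
  (\int[normal_prob m s]_x (expR (t * x))%:E =
   (expR (t * m + t ^+ 2 * s ^+ 2 / 2))%:E)%E.
Proof.
move=> s0; rewrite ge0_integral_normal_prob; last 2 first.
- by apply: measurableT_comp => //; exact: measurable_funM.
- by move=> x; exact: expR_ge0.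
have E x : expR (t * x) * normal_pdf m s x =
    expR (t * m + t ^+ 2 * s ^+ 2 / 2) * normal_pdf (m + t * s ^+ 2) s x.
  rewrite !normal_pdfE// /normal_fun mulrCA [RHS]mulrCA -!expRD.
  by congr (_ * expR _); field.
under eq_integral do rewrite E EFinM.
rewrite ge0_integralZl_EFin ?expR_ge0//.
- by rewrite integral_normal_pdf mule1.
- by move=> x _; rewrite lee_fin normal_pdf_ge0.
- by apply/measurable_EFinP; exact: measurable_normal_pdf.
Qed.

(** The quadratic factor only rescales the density, to standard deviation [s / q]. Negative [a] is
    covered while [1 + a * s ^+ 2] stays positive; both signs serve to identify the variance. *)
Lemma normal_expR_sqr (R : realType) (s a : R) : 0 < s -> 0 < 1 + a * s ^+ 2 ->
  (\int[normal_prob 0 s]_x (expR (- (a * x ^+ 2 / 2)))%:E =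
   ((Num.sqrt (1 + a * s ^+ 2))^-1)%:E)%E.
Proof.
move=> s0 as0; rewrite ge0_integral_normal_prob; last 2 first.
- apply: measurableT_comp => //; apply: measurableT_comp => //.
  apply: measurable_funM => //; apply: measurable_funM => //.
- by move=> x; exact: expR_ge0.
set q := Num.sqrt _; have q0 : 0 < q by rewrite sqrtr_gt0.
have qE : q ^+ 2 = 1 + a * s ^+ 2 by rewrite sqr_sqrtr// ltW.
have E x : expR (- (a * x ^+ 2 / 2)) * normal_pdf 0 s x =
    q^-1 * normal_pdf 0 (s / q) x.
  rewrite !normal_pdfE ?gt_eqF ?divr_gt0// /normal_fun mulrCA -expRD.
  rewrite mulrA; congr (_ * expR _); last first.
    rewrite !subr0 exprMn exprVn qE; field.
    by rewrite !gt_eqF.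
  rewrite /normal_peak -!mulrnAr.
  rewrite (@sqrtrM _ (s ^+ 2)) ?sqr_ge0// (@sqrtrM _ ((s / q) ^+ 2)) ?sqr_ge0//.
  rewrite !sqrtr_sqr !gtr0_norm ?divr_gt0//.
  have : 0 < Num.sqrt (pi *+ 2 : R) by rewrite sqrtr_gt0 pmulrn_lgt0// pi_gt0.
  by move: (Num.sqrt _) => w w0; field; rewrite !gt_eqF.
under eq_integral do rewrite E EFinM.
rewrite ge0_integralZl_EFin ?invr_ge0 ?ltW//.
- by rewrite integral_normal_pdf mule1.
- by move=> x _; rewrite lee_fin normal_pdf_ge0.
- by apply/measurable_EFinP; exact: measurable_normal_pdf.
Qed.


(** * Recovering a Gaussian law from its first two moments *)

Lemma ge0_integral_fin_integrable d (T : measurableType d) (R : realType)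
    (mu : {measure set T -> \bar R}) (f : T -> R) (r : R) :
  measurable_fun setT f -> (forall x, 0 <= f x) ->
  (\int[mu]_x (f x)%:E = r%:E)%E -> mu.-integrable setT (EFin \o f).
Proof.
move=> mf f0 fr; apply/integrableP; split; first exact/measurable_EFinP.
by under eq_integral do rewrite /= ger0_norm//; rewrite fr ltry.
Qed.

(** Domination by [1 + X ^+ 2], which is integrable on a probability space. *)
Lemma sqr_integrable_integrable d (T : measurableType d) (R : realType)
    (P : probability T R) (X : T -> R) : measurable_fun setT X ->
  P.-integrable setT (EFin \o (fun w => X w ^+ 2)) ->
  P.-integrable setT (EFin \o X).
Proof.
move=> mX iX2.
have i1 : P.-integrable setT (EFin \o cst (1 : R)).
  exact: finite_measure_integrable_cst.
apply: (le_integrable measurableT _ _ (integrableD measurableT i1 iX2)).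
  exact/measurable_EFinP.
move=> w _ /=; rewrite lee_fin; apply: le_trans (ler_norm _).
by have := sqr_ge0 (`|X w| - 1); rewrite -(real_normK (num_real (X w))); nra.
Qed.

Lemma ae_eq_cst_probability d (T : measurableType d) (R : realType)
    (P : probability T R) (X : T -> R) (m : R) : measurable_fun setT X ->
  P [set w | X w = m] = 1%E -> {ae P, forall w, X w = m}.
Proof.
move=> mX PX.
have mA : measurable [set w | X w = m].
  by rewrite -[X in measurable X]setTI; exact: (mX measurableT [set m]).
exists (~` [set w | X w = m]); split => //; first exact: measurableC.
by rewrite probability_setC// PX subee.
Qed.

(** As functions of [a] both sides equal 1 at 0, with slopes [- v / 2] and [- u / 2]; a line lying
    below a smooth curve on both sides of a contact point is its tangent there. *)
Lemma sqrt_tangent_unique (R : realType) (u v : R) : 0 < u -> 0 <= v ->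
  (forall a, 0 < 1 + a * u -> 1 - a * v / 2 <= (Num.sqrt (1 + a * u))^-1) ->
  u = v.
Proof.
move=> u0 v0 h.
pose c := v / u; have c0 : 0 <= c by rewrite divr_ge0// ltW.
(* Substituting [1 + a * u = q ^+ 2] removes the root and brings out the factor [q - 1], which
   changes sign at [q = 1]; testing [q] slightly below and slightly above 1 then pins [c]. *)
have hq q : 0 < q -> (q - 1) * (1 - c * (q * (q + 1)) / 2) <= 0.
  move=> q0; have e : 1 + (q ^+ 2 - 1) / u * u = q ^+ 2.
    by rewrite divfK ?gt_eqF//; ring.
  have := h ((q ^+ 2 - 1) / u); rewrite e sqrtr_sqr gtr0_norm// exprn_gt0//.
  move=> /(_ isT); rewrite -(ler_pM2l q0) divff ?gt_eqF// -subr_le0.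
  have -> // : q * (1 - (q ^+ 2 - 1) / u * v / 2) - 1 =
    (q - 1) * (1 - c * (q * (q + 1)) / 2).
  by rewrite /c; field; rewrite gt_eqF.
suff : c = 1 by move=> /(congr1 ( *%R^~ u)); rewrite divfK ?gt_eqF// mul1r.
apply/eqP; rewrite eq_le; apply/andP; split; rewrite leNgt; apply/negP => c1.
- have cp : 0 < c by lra.
  (* At [q = 1 - e] the second factor of [hq] is still negative, so the product of the two factors
     is positive. *)
  pose e := (c - 1) / (2 * c).
  have ce : c * e = (c - 1) / 2 by rewrite /e; field; rewrite gt_eqF.
  have e0 : 0 < e by apply: divr_gt0; lra.
  have e1 : e < 1 by rewrite ltr_pdivrMr; lra.
  by have := hq (1 - e); rewrite subr_gt0 => /(_ e1); nra.
- have := hq (1 + (1 - c) / 2); have : 0 < 1 + (1 - c) / 2 by nra.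
  move=> -> /(_ isT); rewrite leNgt => /negP; apply.
  by apply: mulr_gt0; nra.
Qed.

(* The parameters of the law are read off the two moments with [1 + y <= expR y]:
   applied to [y = t * X] it makes [t * m + t ^+ 2 * s ^+ 2 / 2] nonnegative for
   all [t], so [m = 0]; applied to [y = - a * X ^+ 2 / 2] with [a] of both signs
   it gives [s ^+ 2 = v], because [E expR y] is known from the normalization. *)
Lemma gaussian_mgf d (T : measurableType d) (R : realType)
    (P : probability T R) (X : T -> R) (v : R) : is_gaussian_rv P X ->
  (\int[P]_w (X w)%:E = 0)%E -> (\int[P]_w (X w ^+ 2)%:E = v%:E)%E ->
  (\int[P]_w (expR (X w))%:E = (expR (v / 2))%:E)%E.
Proof.
move=> [mX [m [s gX]]] EX EX2.
have mX2 : measurable_fun setT (fun w => X w ^+ 2) by exact: measurable_funX.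
have iX2 : P.-integrable setT (EFin \o (fun w => X w ^+ 2)).
  by apply: ge0_integral_fin_integrable EX2 => // w; exact: sqr_ge0.
have iX : P.-integrable setT (EFin \o X) by exact: sqr_integrable_integrable.
have v0 : 0 <= v.
  by rewrite -lee_fin -EX2; apply: integral_ge0 => w _; rewrite lee_fin sqr_ge0.
case: gX => [[_ PX]|[s0 lawX]].
(* In the degenerate case [X] is almost surely the constant [m], and the two moments force [m = 0]
   and [v = 0]. *)
- have aeX := @ae_eq_cst_probability _ _ _ _ _ _ mX PX.
  have Ef (f : R -> R) : measurable_fun setT f ->
      (\int[P]_w (f (X w))%:E = (f m)%:E)%E.
    move=> mf; rewrite (_ : (f m)%:E = \int[P]_w (cst (f m)%:E w))%E; last first.
      by rewrite integral_cst//= probability_setT mule1.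
    apply: ae_eq_integral => //; first by apply/measurable_EFinP/measurableT_comp.
    by apply: filterS aeX => w /= ->.
  have m0 : m = 0 by have := Ef id (@measurable_id _ _ _); rewrite EX => -[].
  have : v = 0.
    have := Ef (fun x => x ^+ 2) (exprn_measurable _).
    by rewrite EX2 m0 expr0n /= => -[].
  by move=> ->; rewrite Ef// m0 mul0r.
have lawE (f : R -> R) : measurable_fun setT f -> (forall x, 0 <= f x) ->
    (\int[P]_w (f (X w))%:E = \int[normal_prob m s]_x (f x)%:E)%E.
  move=> mf f0.
  have mX' : measurable_fun setT (X : T -> measurableTypeR R) by [].
  have mf' : measurable_fun setT (EFin \o f : measurableTypeR R -> \bar R).
    exact/measurable_EFinP.
  have := @ge0_integral_pushforward _ _ _ _ _ _ mX' P setT _ measurableT mf'.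
  rewrite preimage_setT => <-; last by move=> x _; rewrite lee_fin.
  by apply: eq_measure_integral => A mA _; exact: lawX.
have mexp (g : R -> R) : measurable_fun setT g ->
    measurable_fun setT (fun x => expR (g x)).
  by move=> mg; exact: measurableT_comp.
have mgfX t : (\int[P]_w (expR (t * X w))%:E =
    (expR (t * m + t ^+ 2 * s ^+ 2 / 2))%:E)%E.
  rewrite (lawE (fun x => expR (t * x))) ?normal_mgf ?gt_eqF//.
  by apply: mexp; exact: measurable_funM.
have i1 : P.-integrable setT (EFin \o cst (1 : R)).
  exact: finite_measure_integrable_cst.
have m0 : m = 0.
  (* The minimizer in [t] of the exponent, whose minimum is [- (m ^+ 2 / (2 * s ^+ 2))]. *)
  pose t := - m / s ^+ 2.
  have : (\int[P]_w (1 + t%:E * (X w)%:E) <= \int[P]_w (expR (t * X w))%:E)%E.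
    apply: le_integral => //.
    - by apply: integrableD => //; exact: integrableZl.
    - apply: ge0_integral_fin_integrable (mgfX t); last by move=> w; exact: expR_ge0.
      by apply: (measurableT_comp (mexp _ _)) => //; exact: measurable_funM.
    - by move=> w _; rewrite lee_fin expR_ge1Dx.
  rewrite integralD//; last exact: integrableZl.
  rewrite integralZl// EX mule0 adde0 integral_cst//= probability_setT mule1.
  rewrite mgfX lee_fin => h; have : ~~ (expR (t * m + t ^+ 2 * s ^+ 2 / 2) < 1).
    by rewrite -leNgt.
  rewrite expR_lt1 -leNgt.
  have -> : t * m + t ^+ 2 * s ^+ 2 / 2 = - (m ^+ 2 / (2 * s ^+ 2)).
    by rewrite /t; field; rewrite gt_eqF.
  rewrite oppr_ge0 pmulr_lle0 ?invr_gt0 ?mulr_gt0 ?exprn_gt0// => m2.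
  by apply/eqP; rewrite -sqrf_eq0 eq_le m2 sqr_ge0.
suff -> : v = s ^+ 2.
  have := mgfX 1; rewrite m0 mulr0 add0r expr1n mul1r => <-.
  by apply: eq_integral => w _; rewrite mul1r.
apply/esym/sqrt_tangent_unique => //; first exact: exprn_gt0.
move=> a a0; rewrite -lee_fin -normal_expR_sqr//.
have mf : measurable_fun setT (fun x : R => expR (- (a * x ^+ 2 / 2))).
  apply: mexp; apply: measurableT_comp => //.
  by apply: measurable_funM => //; exact: measurable_funM.
have f0 (x : R) : 0 <= expR (- (a * x ^+ 2 / 2)) by exact: expR_ge0.
have := lawE _ mf f0; rewrite m0 => <-.
have -> : ((1 - a * v / 2)%:E = \int[P]_w (1 + (- (a / 2))%:E * (X w ^+ 2)%:E))%E.
  rewrite integralD//; last exact: integrableZl.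
  rewrite integralZl// EX2 integral_cst//= probability_setT mule1.
  by rewrite -EFinM -EFinD; congr EFin; ring.
apply: le_integral => //.
- by apply: integrableD => //; exact: integrableZl.
- apply: (@ge0_integral_fin_integrable _ _ _ _ _ ((Num.sqrt (1 + a * s ^+ 2))^-1)) => //.
    exact: (measurableT_comp mf mX).
  by rewrite (lawE _ mf f0) m0 normal_expR_sqr.
- move=> w _; rewrite -EFinM -EFinD lee_fin.
  apply: le_trans (expR_ge1Dx _); rewrite lerD2l le_eqVlt; apply/orP; left.
  by apply/eqP; ring.
Qed.


(** * Correlations of fractional Brownian motion *)

(** The exponent [b + H] is at most both [2 * H] and 1, so [x ^ (b + H)] dominates [x ^ (2 * H)] and
    [x]. The difference [1 - (1 - x) ^ (2 * H)] is at most [x] if [2 * H <= 1], and at most [2 * x]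
    otherwise, by comparison with the square. *)
Lemma fbm_kernel_bound (R : realType) (H b x : R) : 0 < H < 1 ->
  b <= H -> b <= 1 - H -> 0 < x <= 1 ->
  0 <= 1 + x `^ (2 * H) - (1 - x) `^ (2 * H) <= 4 * x `^ (b + H).
Proof.
move=> /andP[H0 H1] bH b1H /andP[x0 x1].
have e1 : x `^ (2 * H) <= x `^ (b + H) by apply: ger_powR; [apply/andP|lra].
have [->|xN1] := eqVneq x 1.
  by rewrite subrr powR0 ?mulf_neq0 ?gt_eqF// !powR1; lra.
have x1' : x < 1 by rewrite lt_neqAle xN1.
have y1 : 0 < 1 - x <= 1 by lra.
have p0 := powR_ge0 x (2 * H).
have p1 := powR_ge0 x (b + H).
have q1 : (1 - x) `^ (2 * H) <= 1.
  by rewrite -[leRHS](powRr0 (1 - x)) ger_powR// mulr_ge0// ltW.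
have [h|h] := leP (2 * H) 1.
  have : x <= x `^ (2 * H) by apply: ger1_powR => //; lra.
  have : 1 - x <= (1 - x) `^ (2 * H) by apply: ger1_powR => //; lra.
  by lra.
have : (1 - x) ^+ 2 <= (1 - x) `^ (2 * H).
  rewrite -powR_mulrn ?ger_powR//; last by lra.
  by lra.
have : x <= x `^ (b + H) by apply: ger1_powR => //; lra.
by have := sqr_ge0 x; nra.
Qed.

(** The covariance is homogeneous of degree [2 * H], so factoring out a power of [t] leaves the
    kernel bound at [x = s / t]. *)
Lemma fbm_cov_bound (R : realType) (H b s t : R) : 0 < H < 1 ->
  b <= H -> b <= 1 - H -> 0 < s <= t ->
  0 <= (t `^ (2 * H) + s `^ (2 * H) - `|t - s| `^ (2 * H)) / 2
    <= 2 * (s / t) `^ b * (t `^ H * s `^ H).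
Proof.
move=> H01 bH b1H /andP[s0 st].
have t0 : 0 < t by exact: lt_le_trans st.
pose x := s / t; have x01 : 0 < x <= 1.
  by rewrite divr_gt0//= ler_pdivrMr// mul1r.
have [x0 x1] := andP x01.
have sE : s = x * t by rewrite divfK// gt_eqF.
have -> : `|t - s| = (1 - x) * t.
  by rewrite ger0_norm ?subr_ge0// sE; ring.
rewrite -/x; clearbody x; rewrite sE !powRM ?(ltW t0) ?(ltW x0) ?subr_ge0//.
have := fbm_kernel_bound H01 bH b1H x01.
have -> : x `^ (b + H) = x `^ b * x `^ H.
  by rewrite powRD// (gt_eqF x0) implybT.
have -> : t `^ (2 * H) = t `^ H * t `^ H.
  by rewrite mulr_natl mulr2n powRD// (gt_eqF t0) implybT.
have tH := powR_gt0 H t0.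
set tp := t `^ H in tH *; set A := x `^ (2 * H); set B := (1 - x) `^ _.
set C := x `^ b; set D := x `^ H => /andP[h1 h2].
have tp2 : 0 < tp * tp by exact: mulr_gt0.
have -> : (tp * tp + A * (tp * tp) - B * (tp * tp)) / 2 =
  (tp * tp) * (1 + A - B) / 2 by ring.
have -> : 2 * C * (tp * (D * tp)) = (tp * tp) * (4 * (C * D)) / 2 by field.
apply/andP; split; first by rewrite divr_ge0// mulr_ge0// ltW.
by rewrite ler_pM2r// ler_pM2l.
Qed.

(* Combine the tangent bounds of [expR] at [0] for the exponents
   [(1 - b) * ln z] and [- b * ln z] with weights [b] and [1 - b]. *)
Lemma powR_le_tangent (R : realType) (b z : R) : 0 <= b <= 1 -> 0 < z ->
  z `^ b <= 1 + b * (z - 1).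
Proof.
move=> /andP[b0 b1] z0; have [u zE] := expR_total z0.
rewrite -zE -expRM.
have e0 := expR_gt0 (u * b).
have h1 : expR (u * b) * (1 + (1 - b) * u) <= expR u.
  rewrite [leRHS](_ : _ = expR (u * b) * expR ((1 - b) * u)).
    by rewrite ler_pM2l// expR_ge1Dx.
  by rewrite -expRD; congr expR; ring.
have h2 : expR (u * b) * (1 - u * b) <= 1.
  rewrite -[leRHS](expRxMexpNx_1 (u * b)) ler_pM2l//.
  exact: (expR_ge1Dx (- (u * b))).
have h1' : b * (expR (u * b) * (1 + (1 - b) * u)) <= b * expR u by exact: ler_wpM2l.
have h2' : (1 - b) * (expR (u * b) * (1 - u * b)) <= (1 - b) * 1.
  by apply: ler_wpM2l => //; rewrite subr_ge0.
rewrite [leLHS](_ : _ = b * (expR (u * b) * (1 + (1 - b) * u)) +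
  (1 - b) * (expR (u * b) * (1 - u * b))); last by ring.
by lra.
Qed.

(** A discrete form of integrating [x ^ (b - 1)]; the induction step is the tangent bound at the
    ratio [(N - 1) / N]. *)
Lemma sum_powR_le (R : realType) (b : R) (n : nat) : 0 < b <= 1 ->
  \sum_(1 <= j < n.+1) (j%:R `^ b / j%:R : R) <= n%:R `^ b / b.
Proof.
move=> /andP[b0 b1]; elim: n => [|n IH].
  by rewrite big_geq// divr_ge0 ?powR_ge0// ltW.
rewrite big_nat_recr//=; apply: le_trans (lerD IH (lexx _)) _.
set N := n.+1%:R : R; have N0 : 0 < N by rewrite ltr0n.
have NE : (n%:R : R) = N - 1 by rewrite /N -natr1 addrK.
suff h : n%:R `^ b <= N `^ b * (1 - b / N).
  have -> : N `^ b / b = N `^ b * (1 - b / N) / b + N `^ b / N.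
    by field; rewrite !gt_eqF.
  by rewrite lerD2r ler_pM2r ?invr_gt0.
(* For [n = 0] the ratio is 0, outside the range of the tangent bound, and the claim is checked
   directly. *)
case: n => [|n] in IH N N0 NE *.
  rewrite powR0 ?gt_eqF// mulr_ge0 ?powR_ge0// subr_ge0.
  by rewrite /N divr1.
have z0 : 0 < (N - 1) / N by rewrite divr_gt0// -NE ltr0n.
have -> : (n.+1%:R : R) = N * ((N - 1) / N) by rewrite mulrC divfK ?gt_eqF.
rewrite powRM ?(ltW N0) ?(ltW z0)// ler_pM2l ?powR_gt0//.
apply: le_trans (@powR_le_tangent _ b _ _ z0) _; first by rewrite b1 ltW.
rewrite le_eqVlt; apply/orP; left; apply/eqP.
by field; rewrite gt_eqF.
Qed.

(** Passing from [n] to [n + 1] adds one row and one column to the double sum, each of total at most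
    [K / b / (n + 1)]. *)
Lemma sum_kernel_le (R : realType) (b K : R) (c : nat -> nat -> R) (n : nat) :
  0 < b <= 1 -> 0 <= K -> (forall j k, c j k = c k j) ->
  (forall j k, (0 < j <= k)%N -> c j k <= K * (j%:R / k%:R) `^ b) ->
  \sum_(1 <= j < n.+1) \sum_(1 <= k < n.+1) c j k / (j%:R * k%:R) <=
  2 * K / b * \sum_(1 <= k < n.+1) k%:R^-1.
Proof.
move=> b01 K0 cC cK; have b0 : 0 < b by case/andP: b01.
elim: n => [|n IH]; first by rewrite !big_geq// mulr0.
have row : \sum_(1 <= j < n.+2) K * (j%:R / n.+1%:R) `^ b / (j%:R * n.+1%:R)
    <= K / b / n.+1%:R.
  set N := n.+1%:R : R; have N0 : 0 < N by rewrite ltr0n.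
  have Nb := powR_gt0 b N0.
  rewrite (_ : \sum_(1 <= j < n.+2) _ =
      K / (N `^ b * N) * \sum_(1 <= j < n.+2) (j%:R `^ b / j%:R : R)).
    apply: le_trans (ler_wpM2l _ (sum_powR_le _ b01)) _.
      by rewrite divr_ge0// mulr_ge0 ?ltW.
    rewrite -/N le_eqVlt; apply/orP; left; apply/eqP.
    by field; rewrite !gt_eqF.
  rewrite mulr_sumr; apply: eq_big_nat => j /andP[j1 _].
  have j0 : (0 : R) < j%:R by rewrite ltr0n.
  rewrite powRM ?invr_ge0 ?ltW//.
  rewrite -powR_inv1 ?(ltW N0)// -powRrM mulN1r powRN.
  by field; rewrite !gt_eqF.
have cle j : (0 < j < n.+2)%N -> c j n.+1 / (j%:R * n.+1%:R) <=
    K * (j%:R / n.+1%:R) `^ b / (j%:R * n.+1%:R).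
  move=> /andP[j0 jn]; rewrite ler_pM2r ?invr_gt0 ?mulr_gt0 ?ltr0n//.
  by rewrite cK// j0.
have t0 j : (0 : R) <= K * (j%:R / n.+1%:R) `^ b / (j%:R * n.+1%:R).
  by rewrite divr_ge0 ?mulr_ge0 ?powR_ge0 ?ler0n.
rewrite big_nat_recr//=.
rewrite (eq_bigr (fun j => \sum_(1 <= k < n.+1) c j k / (j%:R * k%:R) +
   c j n.+1 / (j%:R * n.+1%:R))); last first.
  by move=> j _; rewrite big_nat_recr.
rewrite big_split/= -addrA.
rewrite [X in _ <= _ * X]big_nat_recr//= mulrDr lerD//.
have -> : 2 * K / b / n.+1%:R = K / b / n.+1%:R + K / b / n.+1%:R.
  by field; rewrite ?gt_eqF ?ltr0n.
(* The column stops before the corner entry, which is counted in the row; the bound [row] includes a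
   nonnegative corner term and serves for both. *)
apply: lerD.
  apply: le_trans row; rewrite [leRHS]big_nat_recr//= -[leLHS]addr0 lerD//.
  by apply: ler_sum_nat => j /andP[j0 jn]; apply: cle; rewrite j0 ltnW.
apply: le_trans row; apply: ler_sum_nat => j jn.
by rewrite cC [n.+1%:R * _]mulrC; exact: cle.
Qed.


(** * Logarithmic means *)

(** Induction with [ln (1 + y) <= y] at [y = N^-1] and [y = - N^-1]; at [n = 0] the convention
    [ln 0 = 0] gives the upper bound. *)
Lemma harmonic_sum_bounds (R : realType) (n : nat) :
  ln (n.+1%:R : R) <= \sum_(1 <= k < n.+1) k%:R^-1 <= 1 + ln (n%:R : R).
Proof.
elim: n => [|n /andP[IH1 IH2]].
  by rewrite big_geq// ln1 ln0// addr0 lexx ler01.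
rewrite big_nat_recr//=; set N := n.+1%:R : R in IH1 IH2 *.
have N0 : 0 < N by rewrite ltr0n.
apply/andP; split.
  have -> : (n.+2%:R : R) = N * (1 + N^-1).
    by rewrite mulrDr mulr1 divff ?gt_eqF// natr1.
  rewrite lnM ?posrE//; last by rewrite addr_gt0 ?invr_gt0.
  by rewrite lerD// le_ln1Dx// (lt_trans (ltrN10 _)) ?invr_gt0.
case: n => [|n] in N N0 IH1 IH2 *.
  by rewrite big_geq// add0r /N ln1 invr1 addr0.
apply: le_trans (lerD IH2 (lexx _)) _; rewrite -addrA lerD2l.
have -> : (n.+1%:R : R) = N * (1 - N^-1).
  by rewrite mulrBr mulr1 divff ?gt_eqF// /N -[n.+2%:R]natr1 addrK.
have N1 : N^-1 < 1 by rewrite invf_lt1// ltr1n.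
rewrite lnM ?posrE ?subr_gt0//.
have : ln (1 - N^-1) <= - N^-1 by apply: le_ln1Dx; rewrite ltrN2.
by clear -N; move: (ln (1 - N^-1)) (ln N) (N^-1) => u v w; lra.
Qed.

Lemma cvg_lnn_pinfty (R : realType) : (fun n => ln (n%:R : R)) @ \oo --> +oo%R.
Proof.
apply/cvgryPge => A; near=> n.
have n0 : (0 : R) < n%:R by near: n; exact: nbhs_infty_gtr.
rewrite -[leLHS]expRK ler_ln ?posrE ?expR_gt0//.
by near: n; exact: nbhs_infty_ger.
Unshelve. all: by end_near. Qed.

Lemma cvg_ln_inv (R : realType) : (fun n => (ln (n%:R : R))^-1) @ \oo --> (0 : R).
Proof.
apply/gtr0_cvgV0; last exact: cvg_lnn_pinfty.
by near=> n; apply: ln_gt0; near: n; exact: nbhs_infty_gtr.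
Unshelve. all: by end_near. Qed.

Lemma cvg_harmonic_ln (R : realType) :
  (fun n => (ln (n%:R : R))^-1 * \sum_(1 <= k < n.+1) k%:R^-1) @ \oo --> (1 : R).
Proof.
apply: (@squeeze_cvgr _ _ _ _ (fun=> 1) (fun n => (ln (n%:R : R))^-1 + 1)).
- near=> n.
  have n1 : (1 : R) < n%:R by near: n; exact: nbhs_infty_gtr.
  have l0 : 0 < ln (n%:R : R) by exact: ln_gt0.
  have /andP[h1 h2] := harmonic_sum_bounds R n.
  rewrite -{1}(mulVf (lt0r_neq0 l0)) ler_pM2l ?invr_gt0//.
  apply/andP; split.
    apply: le_trans h1; rewrite ler_ln ?posrE ?(lt_trans ltr01 n1)//.
    by rewrite ler_nat.
  rewrite -[X in _ <= _ + X](mulVf (lt0r_neq0 l0)) -{2}[_^-1]mulr1 -mulrDr.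
  by rewrite ler_pM2l ?invr_gt0.
- exact: cvg_cst.
- rewrite -[X in _ --> X]add0r; apply: cvgD; [exact: cvg_ln_inv|exact: cvg_cst].
Unshelve. all: by end_near. Qed.

Definition log_mean (R : realType) (a : nat -> R) (n : nat) : R :=
  (ln (n%:R : R))^-1 * \sum_(1 <= k < n.+1) k%:R^-1 * a k.

Lemma ln_2sqr (R : realType) (m : nat) :
  ln ((2 ^ (m ^ 2))%:R : R) = (m ^ 2)%:R * ln 2.
Proof. by rewrite natrX lnXn// mulr_natl. Qed.

Lemma cvg_2sqr : (fun m => 2 ^ (m ^ 2))%N @ \oo --> \oo.
Proof.
apply/cvgnyPge => A; exists A => // m /= Am.
apply: leq_trans (ltnW (ltn_expl _ _)) => //; apply: leq_trans Am _.
by case: m => // m; rewrite -[leqLHS]muln1 expnS leq_mul2l expn_gt0.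
Qed.

Lemma bracket_2sqr (M n : nat) : (2 ^ (M ^ 2) <= n)%N ->
  exists2 m, (M <= m)%N & (2 ^ (m ^ 2) <= n < 2 ^ (m.+1 ^ 2))%N.
Proof.
move=> Mn; have ex : exists m, (2 ^ (m ^ 2) <= n)%N by exists M.
have ub m : (2 ^ (m ^ 2) <= n)%N -> (m <= n)%N.
  apply: leq_trans; apply: leq_trans (ltnW (ltn_expl _ _)) => //.
  by case: m => // m; rewrite -[leqLHS]muln1 expnS leq_mul2l expn_gt0.
case: (ex_maxnP ex ub) => m mn max; exists m; first exact: max.
by rewrite mn ltnNge; apply/negP => /max; rewrite ltnn.
Qed.

(** The unnormalized sums are nondecreasing. Between consecutive points [2 ^ (m ^ 2)] the mean is
    therefore trapped by the means at the two ends, up to the ratio of their logarithms, which tends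
    to 1. *)
Lemma log_mean_interpolation (R : realType) (a : nat -> R) (l : R) :
  (forall k, 0 <= a k) ->
  (fun m => (m ^ 2)%:R^-1 *
     \sum_(1 <= k < (2 ^ (m ^ 2)).+1) k%:R^-1 * (a k - l)) @ \oo --> (0 : R) ->
  log_mean a @ \oo --> l.
Proof.
move=> a0 h; have l2 : 0 < ln (2 : R) by rewrite ln_gt0// ltr1n.
pose A n := \sum_(1 <= k < n.+1) k%:R^-1 * a k.
have A0 n : 0 <= A n by apply: sumr_ge0 => k _; rewrite mulr_ge0 ?invr_ge0.
have Amono n p : (n <= p)%N -> A n <= A p.
  move=> np; rewrite /A (@big_cat_nat _ _ _ n.+1 1 p.+1)//= lerDl.
  by apply: sumr_ge0 => k _; rewrite mulr_ge0 ?invr_ge0.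
pose N m := (2 ^ (m ^ 2))%N.
have LN : (fun m => log_mean a (N m)) @ \oo --> l.
  (* Splits off the centring: [ln (N m)] is [m ^ 2] times [ln 2], and the subtracted [l] returns
     times a normalized harmonic sum, which tends to 1. *)
  have -> : (fun m => log_mean a (N m)) = (fun m => (ln 2)^-1 * ((m ^ 2)%:R^-1 *
     \sum_(1 <= k < (2 ^ (m ^ 2)).+1) k%:R^-1 * (a k - l)) +
     l * ((ln ((N m)%:R : R))^-1 * \sum_(1 <= k < (N m).+1) k%:R^-1)).
    apply/funext => m; rewrite /log_mean -/(N m).
    have -> : \sum_(1 <= k < (N m).+1) k%:R^-1 * (a k - l) =
        \sum_(1 <= k < (N m).+1) k%:R^-1 * a k -
        l * \sum_(1 <= k < (N m).+1) k%:R^-1.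
      by rewrite mulr_sumr -sumrB; apply: eq_bigr => k _; ring.
    by rewrite ln_2sqr invfM; ring.
  rewrite -[X in _ --> X]add0r -[X in _ --> X + _](mulr0 (ln 2)^-1).
  apply: cvgD; first exact: cvgMr.
  rewrite -[X in _ --> X]mulr1; apply: cvgMr.
  exact: (cvg_comp _ _ cvg_2sqr (@cvg_harmonic_ln R)).
(* The ratio of [ln (N p.+2)] to [ln (N p.+1)], since [harmonic p] is [1 / (p + 1)]. *)
pose r p : R := (1 + harmonic p) ^+ 2.
have r0 p : 0 < r p by rewrite exprn_gt0// addr_gt0// /harmonic/= invr_gt0.
have rE p : r p = (p.+2 ^ 2)%:R / (p.+1 ^ 2)%:R.
  rewrite !natrX -expr_div_n /r; congr (_ ^+ 2).
  by rewrite /harmonic/= -[p.+2%:R]natr1 mulrDl divff ?pnatr_eq0// mul1r.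
have rcvg : r @ \oo --> (1 : R).
  have h1 : (fun p => 1 + harmonic p : R) @ \oo --> (1 + 0 : R).
    by apply: cvgD; [exact: cvg_cst|exact: cvg_harmonic].
  have h2 := @cvgM _ _ _ _ _ _ _ _ h1 h1; rewrite addr0 mulr1 in h2.
  exact: h2.
have Ucvg : (fun p => log_mean a (N p.+2) * r p) @ \oo --> l.
  rewrite -[X in _ --> X]mulr1; apply: cvgM => //.
  by have := LN; rewrite -(cvg_shiftn 2); under eq_fun do rewrite addn2.
have Vcvg : (fun p => log_mean a (N p.+1) / r p) @ \oo --> l.
  rewrite -[X in _ --> X]divr1; apply: cvgM.
    by have := LN; rewrite -(cvg_shiftn 1); under eq_fun do rewrite addn1.
  by apply: cvgV => //; rewrite oner_eq0.
apply/cvgrPdist_le => e e0.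
have /cvgrPdist_le/(_ _ e0)[M1 _ HU] := Ucvg.
have /cvgrPdist_le/(_ _ e0)[M2 _ HV] := Vcvg.
pose M := maxn M1 M2.
(* Starting at [N M.+1] makes the bracketing index a successor, which avoids [ln (N 0) = 0]. *)
exists (N M.+1) => // n /= /bracket_2sqr[[//|m] Mm /andP[mn nm]].
have {}HU := HU m (leq_trans (leq_maxl _ _) Mm).
have {}HV := HV m (leq_trans (leq_maxr _ _) Mm).
have p0 k : 0 < ln ((N k.+1)%:R : R) by rewrite /N ln_2sqr mulr_gt0// ltr0n.
have nge : (N m.+1)%:R <= (n%:R : R) by rewrite ler_nat.
have N0 k : (0 : R) < (N k)%:R by rewrite ltr0n expn_gt0.
have n0 : (0 : R) < n%:R by exact: lt_le_trans nge.
have l1 : ln ((N m.+1)%:R : R) <= ln (n%:R : R) by rewrite ler_ln ?posrE.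
have l3 : ln (n%:R : R) <= ln ((N m.+2)%:R : R).
  by rewrite ler_ln ?posrE// ler_nat ltnW.
have ln0 : 0 < ln (n%:R : R) by exact: lt_le_trans l1.
have Nr : ln ((N m.+2)%:R : R) = r m * ln ((N m.+1)%:R : R).
  by rewrite /N !ln_2sqr rE mulrA divfK// pnatr_eq0 expn_eq0.
have up : log_mean a n <= log_mean a (N m.+2) * r m.
  rewrite {1}/log_mean -/(A n) /log_mean -/(A (N m.+2)) Nr invfM.
  have -> : (r m)^-1 / ln (N m.+1)%:R * A (N m.+2) * r m =
    (ln (N m.+1)%:R)^-1 * A (N m.+2) by field; rewrite !gt_eqF.
  apply: ler_pM => //; first by rewrite invr_ge0 ltW.
    by rewrite lef_pV2 ?posrE.
  exact/Amono/ltnW.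
have lo : log_mean a (N m.+1) / r m <= log_mean a n.
  rewrite [leRHS]/log_mean -/(A n) /log_mean -/(A (N m.+1)).
  have -> : (ln (N m.+1)%:R)^-1 * A (N m.+1) / r m =
    (ln (N m.+2)%:R)^-1 * A (N m.+1) by rewrite Nr; field; rewrite !gt_eqF.
  apply: ler_pM => //; first by rewrite invr_ge0 ltW// p0.
    by rewrite lef_pV2 ?posrE.
  exact/Amono.
move: HU HV; rewrite !ler_norml => /andP[u1 u2] /andP[v1 v2].
by apply/andP; split; lra.
Qed.


(** * Functions with convergent logarithmic means *)

(** Here [x] is a fixed path. The exponential growth bound is part of the class so that its members
    are integrable for the Gaussian law. *)
Definition log_cvg (R : realType) (x : nat -> R) (f : R -> R) : Prop :=
  [/\ continuous f,
      exists C c, forall t, `|f t| <= C * expR (c * `|t|)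
    & log_mean (fun k => f (x k)) @ \oo --> \int[normal_prob (0 : R) 1]_t f t].

Lemma expR_norm_le (R : realType) (c t : R) :
  expR (c * `|t|) <= expR (c * t) + expR (- c * t).
Proof.
have [t0|t0] := leP 0 t; first by rewrite ger0_norm// lerDl expR_ge0.
by rewrite ltr0_norm// mulrN mulNr lerDr expR_ge0.
Qed.

Lemma integrable_expR_normal (R : realType) (c : R) :
  (@normal_prob R 0 1).-integrable setT (fun t => (expR (c * t))%:E).
Proof.
apply: (ge0_integral_fin_integrable _ _ (normal_mgf 0 c (oner_neq0 R))).
- by apply: measurableT_comp => //; exact: measurable_funM.
- by move=> t; exact: expR_ge0.
Qed.

Lemma integrable_exp_growth (R : realType) (f : R -> R) (C c : R) :
  continuous f -> (forall t, `|f t| <= C * expR (c * `|t|)) ->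
  (@normal_prob R 0 1).-integrable setT (EFin \o f).
Proof.
move=> cf fb.
have iW := integrableZl measurableT C
  (integrableD measurableT (integrable_expR_normal c) (integrable_expR_normal (- c))).
apply: le_integrable iW => //.
  by apply/measurable_EFinP; exact: continuous_measurable_fun.
move=> t _ /=; rewrite lee_fin; apply: le_trans (fb t) _.
apply: le_trans (ler_norm _); apply: ler_wpM2l (expR_norm_le _ _).
have : 0 <= C * expR (c * `|t|) by apply: le_trans (fb t).
by rewrite pmulr_lge0// expR_gt0.
Qed.

Lemma log_cvg_integrable (R : realType) (x : nat -> R) (f : R -> R) :
  log_cvg x f -> (@normal_prob R 0 1).-integrable setT (EFin \o f).
Proof. by move=> [cf [C [c fb]] _]; exact: integrable_exp_growth fb. Qed.

Lemma log_mean_linear (R : realType) (u v : nat -> R) (a b : R) (n : nat) :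
  log_mean (fun k => a * u k + b * v k) n = a * log_mean u n + b * log_mean v n.
Proof.
rewrite /log_mean (eq_bigr (fun k => a * (k%:R^-1 * u k) + b * (k%:R^-1 * v k))).
  by rewrite big_split/= -!mulr_sumr; ring.
by move=> k _; ring.
Qed.

Lemma ler_log_mean (R : realType) (u v : nat -> R) (n : nat) :
  (forall k, u k <= v k) -> log_mean u n <= log_mean v n.
Proof.
move=> uv; rewrite ler_wpM2l//.
  rewrite invr_ge0; case: n => [|n]; first by rewrite ln0.
  by rewrite ln_ge0// ler1n.
by apply: ler_sum => k _; rewrite ler_wpM2l ?invr_ge0.
Qed.

Lemma log_cvg_linear (R : realType) (x : nat -> R) (f g : R -> R) (a b : R) :
  log_cvg x f -> log_cvg x g -> log_cvg x (fun t => a * f t + b * g t).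
Proof.
move=> hf hg; have iF := log_cvg_integrable hf; have iG := log_cvg_integrable hg.
case: hf => cf [C [c fb]] lf; case: hg => cg [D [d gb]] lg; split.
- by move=> t; apply: cvgD; apply: cvgMr; [exact: cf|exact: cg].
- exists (`|a| * `|C| + `|b| * `|D|), (`|c| + `|d|) => t.
  apply: le_trans (ler_normD _ _) _; rewrite !normrM mulrDl -!mulrA.
  apply: lerD; apply: ler_wpM2l => //.
    apply: le_trans (fb t) _; apply: ler_pM; rewrite ?expR_ge0//.
    - have : 0 <= C * expR (c * `|t|) by apply: le_trans (fb t).
      by rewrite pmulr_lge0// expR_gt0.
    - exact: ler_norm.
    - rewrite ler_expR ler_wpM2r//; apply: le_trans (ler_norm _) _.
      by rewrite lerDl.
  apply: le_trans (gb t) _; apply: ler_pM; rewrite ?expR_ge0//.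
  - have : 0 <= D * expR (d * `|t|) by apply: le_trans (gb t).
    by rewrite pmulr_lge0// expR_gt0.
  - exact: ler_norm.
  - rewrite ler_expR ler_wpM2r//; apply: le_trans (ler_norm _) _.
    by rewrite lerDr.
- rewrite RintegralD//; [|exact: (integrableZl measurableT a iF)|
    exact: (integrableZl measurableT b iG)].
  rewrite !RintegralZl//.
  rewrite (_ : log_mean _ = fun n => a * log_mean (fun k => f (x k)) n +
    b * log_mean (fun k => g (x k)) n); last by apply/funext => n; exact: log_mean_linear.
  by apply: cvgD; apply: cvgMr.
Qed.

Lemma log_cvg_expR (R : realType) (x : nat -> R) (c : R) :
  log_mean (fun k => expR (c * x k)) @ \oo --> expR (c ^+ 2 / 2) ->
  log_cvg x (fun t => expR (c * t)).
Proof.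
move=> h; split.
- move=> t; apply: continuous_comp; last exact: continuous_expR.
  by apply: cvgMr; exact: cvg_id.
- exists 1, `|c| => t; rewrite mul1r ger0_norm ?expR_ge0// ler_expR -normrM.
  exact: ler_norm.
- by rewrite /Rintegral normal_mgf ?oner_neq0//= mulr0 add0r expr1n mulr1.
Qed.

(** Countably many exponents, so that one null set of paths can be discarded for all of them at
    once. *)
Definition exp_log_cvg (R : realType) (x : nat -> R) : Prop :=
  forall q : rat, log_mean (fun k => expR (ratr q * x k)) @ \oo -->
    expR ((ratr q : R) ^+ 2 / 2).

(** A three-epsilon argument: the weight is dominated by a sum of two exponentials whose logarithmic
    means converge, hence stay bounded. A natural [c] keeps the exponents rational. *)
Lemma log_cvg_closed (R : realType) (x : nat -> R) (f : R -> R) (c : nat) :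
  exp_log_cvg x -> continuous f ->
  (forall e, 0 < e -> exists2 g, log_cvg x g &
     forall t, `|f t - g t| <= e * expR (c%:R * `|t|)) ->
  log_cvg x f.
Proof.
move=> hx cf happ.
have hW : log_cvg x (fun t => 1 * expR (c%:R * t) + 1 * expR (- c%:R * t)).
  apply: log_cvg_linear; apply: log_cvg_expR.
    by have := hx c%:R; rewrite ratr_nat.
  by have := hx (- c%:R); rewrite rmorphN/= ratr_nat.
pose W t := 1 * expR (c%:R * t) + 1 * expR (- c%:R * t) : R.
have VW t : expR (c%:R * `|t|) <= W t by rewrite /W !mul1r expR_norm_le.
have W0 t : 0 <= W t by apply: le_trans (VW t); exact: expR_ge0.
have fgrowth : exists C d, forall t, `|f t| <= C * expR (d * `|t|).
  have [g [cg [C [d gb]] _] fg] := happ 1 ltr01.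
  exists (1 + `|C|), (c%:R + `|d|) => t.
  have -> : f t = (f t - g t) + g t by ring.
  apply: le_trans (ler_normD _ _) _; rewrite mulrDl; apply: lerD.
    apply: le_trans (fg t) _; rewrite ler_wpM2l// ler_expR ler_wpM2r//.
    by rewrite lerDl.
  apply: le_trans (gb t) _; apply: ler_pM; rewrite ?expR_ge0//.
  - have : 0 <= C * expR (d * `|t|) by apply: le_trans (gb t).
    by rewrite pmulr_lge0// expR_gt0.
  - exact: ler_norm.
  - rewrite ler_expR ler_wpM2r//; apply: le_trans (ler_norm _) _.
    by rewrite lerDr.
split => //.
have iF : (@normal_prob R 0 1).-integrable setT (EFin \o f).
  by case: fgrowth => C [d fb]; exact: integrable_exp_growth fb.
have iW := log_cvg_integrable hW.
pose IW := \int[normal_prob (0 : R) 1]_t W t.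
have IW0 : 0 <= IW by apply: Rintegral_ge0.
apply/cvgrPdist_le => e e0.
(* [K] bounds both the integral of [W] and, eventually, its logarithmic means. *)
pose K := IW + 1; have K0 : 0 < K by rewrite ltr_wpDl.
pose d := e / (3 * K); have d0 : 0 < d by rewrite divr_gt0// mulr_gt0.
have [g hg fg] := happ d d0.
have iG := log_cvg_integrable hg.
have fgW t : `|f t - g t| <= d * W t.
  by apply: le_trans (fg t) _; rewrite ler_pM2l.
have dK : d * K = e / 3 by rewrite /d; field; rewrite gt_eqF.
have Ifg : `|\int[normal_prob (0 : R) 1]_t f t - \int[normal_prob (0 : R) 1]_t g t|
    <= e / 3.
  rewrite -RintegralB//.
  apply: le_trans (le_normr_Rintegral _ _) _ => //.
    exact: (integrableB measurableT iF iG).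
  apply: (@le_trans _ _ (d * IW)).
    rewrite -RintegralZl//; apply: le_Rintegral => //.
    - exact: (integrable_abse (integrableB measurableT iF iG)).
    - exact: (integrableZl measurableT d iW).
  by rewrite -dK ler_pM2l// lerDl.
have e30 : 0 < e / 3 by rewrite divr_gt0.
case: hg => _ _ /cvgrPdist_le/(_ _ e30) hg.
case: hW => _ _ /cvgrPdist_le/(_ 1 ltr01) hW.
near=> n.
have Lfg : `|log_mean (fun k => f (x k)) n - log_mean (fun k => g (x k)) n| <= e / 3.
  have E : log_mean (fun k => f (x k)) n - log_mean (fun k => g (x k)) n =
      log_mean (fun k => 1 * f (x k) + -1 * g (x k)) n.
    by rewrite log_mean_linear; ring.
  have LW : log_mean (fun k => W (x k)) n <= K.
    have : `|IW - log_mean (fun k => W (x k)) n| <= 1 by near: n.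
    by rewrite ler_norml => /andP[]; rewrite /K; lra.
  have LdW : log_mean (fun k => d * W (x k) + 0 * 0) n <= e / 3.
    by rewrite log_mean_linear mul0r addr0 -dK ler_pM2l.
  rewrite E ler_norml; apply/andP; split.
    rewrite lerNl; apply: le_trans LdW.
    have -> : - log_mean (fun k => 1 * f (x k) + -1 * g (x k)) n =
      log_mean (fun k => -1 * f (x k) + 1 * g (x k)) n.
      by rewrite !log_mean_linear; ring.
    apply: ler_log_mean => k; have := fgW (x k); rewrite ler_norml => /andP[].
    by lra.
  apply: le_trans LdW.
  apply: ler_log_mean => k; have := fgW (x k); rewrite ler_norml => /andP[].
  by lra.
have Lg : `|\int[normal_prob (0 : R) 1]_t g t - log_mean (fun k => g (x k)) n| <= e / 3.
  by near: n.
move: Ifg Lfg Lg; rewrite !ler_norml => /andP[? ?] /andP[? ?] /andP[? ?].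
by apply/andP; split; lra.
Unshelve. all: by end_near. Qed.


(** * From exponentials to polynomials and cosines *)

(** The bounds [y <= expR y - 1 <= y * expR y] give a remainder between 0 and [y * (expR y - 1)];
    applying them again yields the square. *)
Lemma expR_sub1_sub_le (R : realType) (y : R) :
  `|expR y - 1 - y| <= y ^+ 2 * expR `|y|.
Proof.
have h1 := expR_ge1Dx y; have h2 := expR_ge1Dx (- y).
have e0 := expR_gt0 y.
have h3 : expR y - 1 <= y * expR y.
  have : expR y * (1 - y) <= expR y * expR (- y) by rewrite ler_pM2l.
  by rewrite expRxMexpNx_1; lra.
rewrite ger0_norm; last by lra.
have [y0|y0] := leP 0 y.
  rewrite (ger0_norm y0) expr2 -mulrA.
  apply: (@le_trans _ _ (y * (expR y - 1))); first by lra.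
  exact: ler_wpM2l.
rewrite (ltr0_norm y0).
apply: (@le_trans _ _ (y ^+ 2)).
  apply: (@le_trans _ _ (y * (expR y - 1))); first by lra.
  by rewrite expr2 ler_nM2l//; lra.
by rewrite ler_peMr ?sqr_ge0//; lra.
Qed.

Lemma exprn_le_expR (R : realType) (t : R) (m : nat) :
  `|t| ^+ m <= m`!%:R * expR `|t|.
Proof.
case: m => [|m]; first by rewrite expr0 fact0 mul1r -expR0 ler_expR.
rewrite mulrC -ler_pdivrMr ?ltr0n ?fact_gt0//.
by apply: le_trans (expR_ge1Dxn m (normr_ge0 t)); rewrite lerDr.
Qed.

Lemma continuous_expR_mul (R : realType) (c : R) :
  continuous (fun t : R => expR (c * t)).
Proof.
move=> t; apply: continuous_comp; last exact: continuous_expR.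
by apply: cvgMr; exact: cvg_id.
Qed.

Lemma ratrDV (R : realType) (q : rat) (n : nat) :
  ratr (q + n.+1%:R^-1) = ratr q + n.+1%:R^-1 :> R.
Proof. by rewrite rmorphD fmorphV rmorph_nat. Qed.

(** Induction on [m]: multiplication by [t] is differentiation in the exponent, and the difference
    quotient with rational step [1 / (n + 1)] converges in a weighted norm. *)
Lemma log_cvg_monomial_expR (R : realType) (x : nat -> R) (m : nat) (q : rat) :
  exp_log_cvg x -> log_cvg x (fun t => t ^+ m * expR (ratr q * t)).
Proof.
move=> hx; elim: m => [|m IH] in q *.
  have := log_cvg_expR (hx q); congr log_cvg; apply/funext => t.
  by rewrite expr0 mul1r.
pose r : R := ratr q.
(* The weight exceeds [|r|] by 2: one unit for the remainder of the exponential, one to absorb the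
   power of [t]. *)
apply: (@log_cvg_closed _ _ _ (Num.bound `|r|).+2) => //.
  move=> t; apply: cvgM; last exact: continuous_expR_mul.
  exact: exprn_continuous.
move=> e e0; pose K : R := (m.+2)`!%:R.
have K0 : 0 < K by rewrite ltr0n fact_gt0.
pose n := Num.bound (K / e); pose d : R := n.+1%:R^-1.
have d0 : 0 < d by rewrite invr_gt0.
have d1 : d <= 1 by rewrite invf_le1// ler1n.
have dK : d * K <= e.
  rewrite mulrC ler_pdivrMr ?ltr0n// mulrC -ler_pdivrMr//.
  apply: ltW; apply: lt_le_trans (archi_boundP _) _; first by rewrite divr_ge0 ?ltW.
  by rewrite ler_nat.
exists (fun t => d^-1 * (t ^+ m * expR (ratr (q + n.+1%:R^-1) * t)) +
   (- d^-1) * (t ^+ m * expR (ratr q * t))).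
  by apply: log_cvg_linear; exact: IH.
move=> t; rewrite ratrDV -/r -/d.
have -> : t ^+ m.+1 * expR (r * t) - (d^-1 * (t ^+ m * expR ((r + d) * t)) +
    - d^-1 * (t ^+ m * expR (r * t))) =
    - d^-1 * (t ^+ m * expR (r * t)) * (expR (d * t) - 1 - d * t).
  by rewrite mulrDl expRD exprS; field; rewrite gt_eqF.
have dV : 0 < d^-1 by rewrite invr_gt0.
rewrite normrM normrM normrN (gtr0_norm dV) normrM normrX (gtr0_norm (expR_gt0 _)).
apply: (@le_trans _ _ (d^-1 * (`|t| ^+ m * expR (`|r| * `|t|)) *
   ((d * t) ^+ 2 * expR `|t|))).
  apply: ler_pM => //.
  - by rewrite !mulr_ge0 ?exprn_ge0 ?expR_ge0 ?(ltW dV).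
  - rewrite ler_pM2l ?invr_gt0// ler_wpM2l ?exprn_ge0// ler_expR -normrM.
    exact: ler_norm.
  - apply: le_trans (expR_sub1_sub_le _) _.
    rewrite ler_wpM2l ?sqr_ge0// ler_expR normrM (gtr0_norm d0).
    by rewrite ler_piMl.
have -> : d^-1 * (`|t| ^+ m * expR (`|r| * `|t|)) * ((d * t) ^+ 2 * expR `|t|) =
    d * `|t| ^+ m.+2 * expR ((`|r| + 1) * `|t|).
  rewrite mulrDl mul1r expRD exprMn -(real_normK (num_real t)).
  have -> : `|t| ^+ m.+2 = `|t| ^+ 2 * `|t| ^+ m by rewrite -exprD.
  by field; rewrite gt_eqF.
apply: (@le_trans _ _ (d * (K * expR `|t|) * expR ((`|r| + 1) * `|t|))).
  by rewrite ler_pM2r ?expR_gt0// ler_pM2l// exprn_le_expR.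
have -> : d * (K * expR `|t|) * expR ((`|r| + 1) * `|t|) =
    d * K * expR ((`|r| + 2) * `|t|).
  by rewrite mulrA -mulrA -expRD; congr (_ * expR _); ring.
apply: ler_pM; rewrite ?expR_ge0//; first by rewrite ltW// mulr_gt0.
rewrite ler_expR ler_wpM2r//.
rewrite -[(Num.bound _).+2]addn2 natrD lerD2r ltW//.
exact: archi_boundP.
Qed.

Lemma log_cvg_monomial (R : realType) (x : nat -> R) (m : nat) :
  exp_log_cvg x -> log_cvg x (fun t => t ^+ m).
Proof.
move=> /(@log_cvg_monomial_expR _ _ m 0); congr log_cvg; apply/funext => t.
by rewrite rmorph0 mul0r expR0 mulr1.
Qed.

Lemma log_cvg_cst (R : realType) (x : nat -> R) (c : R) :
  exp_log_cvg x -> log_cvg x (fun=> c).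
Proof.
move=> /(@log_cvg_monomial _ _ 0) h.
have := log_cvg_linear c 0 h h; congr log_cvg; apply/funext => t.
by rewrite expr0; ring.
Qed.

Lemma log_cvg_poly (R : realType) (x : nat -> R) (c : nat -> R) (n : nat) :
  exp_log_cvg x -> log_cvg x (fun t => \sum_(0 <= k < n) c k * t ^+ k).
Proof.
move=> hx; elim: n => [|n IH].
  have := log_cvg_cst 0 hx; congr log_cvg; apply/funext => t.
  by rewrite big_geq.
have := log_cvg_linear 1 (c n) IH (log_cvg_monomial n hx).
congr log_cvg; apply/funext => t.
by rewrite big_nat_recr//= mul1r.
Qed.

(** For [k >= n] the factor [2 ^ (k - n)] is at least 1, so the tail is at most [2 ^ (- n)] times
    the exponential series at [2 * |y|]. *)
Lemma entire_tail_bound (R : realType) (c : nat -> R) (l y : R) (n : nat) :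
  (forall k, `|c k| <= k`!%:R^-1) ->
  (fun N => \sum_(0 <= k < N) c k * y ^+ k) @ \oo --> l ->
  `|l - \sum_(0 <= k < n) c k * y ^+ k| <= 2^-1 ^+ n * expR (2 * `|y|).
Proof.
move=> cb hl; set S := fun N => \sum_(0 <= k < N) c k * y ^+ k in hl *.
have h : (fun N => `|S N - S n|) @ \oo --> `|l - S n|.
  by apply: cvg_norm; apply: cvgB => //; exact: cvg_cst.
apply: (cvgr_to_le h); near=> N.
have nN : (n <= N)%N by near: N; exact: nbhs_infty_ge.
rewrite /S (@big_cat_nat _ _ _ n 0 N)//= addrAC subrr add0r.
apply: le_trans (ler_norm_sum _ _ _) _.
apply: (@le_trans _ _ (\sum_(n <= k < N) 2^-1 ^+ n * (exp_coeff (2 * `|y|) k))).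
  apply: ler_sum_nat => k /andP[nk _].
  rewrite normrM normrX /exp_coeff/= exprMn.
  apply: (@le_trans _ _ (k`!%:R^-1 * `|y| ^+ k)); first by rewrite ler_wpM2r// exprn_ge0.
  rewrite -(subnK nk) addnC !exprD.
  have -> : 2^-1 ^+ n * (2 ^+ n * 2 ^+ (k - n) * (`|y| ^+ n * `|y| ^+ (k - n)) /
      (n + (k - n))`!%:R) = 2 ^+ (k - n) * ((n + (k - n))`!%:R^-1 *
      (`|y| ^+ n * `|y| ^+ (k - n))).
    rewrite exprVn; field.
    by rewrite expf_neq0 ?pnatr_eq0//= -lt0n fact_gt0.
  apply: ler_peMl; last by rewrite exprn_ege1// ler1n.
  by rewrite mulr_ge0 ?invr_ge0// mulr_ge0 ?exprn_ge0.
rewrite -mulr_sumr ler_wpM2l ?exprn_ge0//.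
apply: (@le_trans _ _ (series (exp_coeff (2 * `|y|)) N)).
  rewrite /series/= [leRHS](@big_cat_nat _ _ _ n 0 N)//= lerDr.
  by apply: sumr_ge0 => k _; apply: exp_coeff_ge0; rewrite mulr_ge0.
rewrite /expR.
apply: nondecreasing_cvgn_le; last exact: is_cvg_series_exp_coeff.
apply/nondecreasing_series => k _ _; apply: exp_coeff_ge0.
by rewrite mulr_ge0.
Unshelve. all: by end_near. Qed.

Lemma log_cvg_entire (R : realType) (x : nat -> R) (f : R -> R) (c : nat -> R)
    (a : R) : exp_log_cvg x -> continuous f ->
  (forall k, `|c k| <= k`!%:R^-1) ->
  (forall y, (fun N => \sum_(0 <= k < N) c k * y ^+ k) @ \oo --> f y) ->
  log_cvg x (fun t => f (a * t)).
Proof.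
move=> hx cf cb hf.
apply: (@log_cvg_closed _ _ _ (Num.bound (2 * `|a|))) => //.
  move=> t; apply: continuous_comp; last exact: cf.
  by apply: cvgMr; exact: cvg_id.
move=> e e0.
have : (fun n => (2^-1 : R) ^+ n) @ \oo --> (0 : R).
  by apply: cvg_expr; rewrite ger0_norm// invf_lt1// ltr1n.
move=> /cvgrPdist_le/(_ _ e0)[n _ /(_ n (leqnn _))]; rewrite sub0r normrN /= => ne.
exists (fun t => \sum_(0 <= k < n) (c k * a ^+ k) * t ^+ k).
  exact: log_cvg_poly.
move=> t; rewrite (eq_bigr (fun k => c k * (a * t) ^+ k)); last first.
  by move=> k _; rewrite exprMn mulrA.
apply: le_trans (entire_tail_bound n cb (hf _)) _.
apply: ler_pM; rewrite ?expR_ge0 ?exprn_ge0//.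
  by apply: le_trans ne; exact: ler_norm.
rewrite ler_expR normrM mulrA ler_wpM2r// ltW//.
by apply: archi_boundP; rewrite mulr_ge0.
Qed.

Lemma log_cvg_cos (R : realType) (x : nat -> R) (a b : R) :
  exp_log_cvg x -> log_cvg x (fun t => cos (a * t + b)).
Proof.
move=> hx.
have h1 : log_cvg x (fun t => cos (a * t)).
  apply: (@log_cvg_entire _ _ _ (fun k => (~~ odd k)%:R * (-1) ^+ k./2 / k`!%:R)) => //.
  - exact: continuous_cos.
  - move=> k; rewrite !normrM normrX normrN1 expr1n mulr1 normfV !ger0_norm//.
    by rewrite ler_piMl ?invr_ge0//; case: (odd k).
  - move=> y; have := @is_cvg_series_cos_coeff R y.
    rewrite cos.unlock /series/= cos_coeffE; exact.
have h2 : log_cvg x (fun t => sin (a * t)).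
  apply: (@log_cvg_entire _ _ _ (fun k => (odd k)%:R * (-1) ^+ k.-1./2 / k`!%:R)) => //.
  - exact: continuous_sin.
  - move=> k; rewrite !normrM normrX normrN1 expr1n mulr1 normfV !ger0_norm//.
    by rewrite ler_piMl ?invr_ge0//; case: (odd k).
  - move=> y; have := @is_cvg_series_sin_coeff R y.
    rewrite sin.unlock /series/= sin_coeffE; exact.
have := log_cvg_linear (cos b) (- sin b) h1 h2; congr log_cvg.
by apply/funext => t; rewrite cosD; ring.
Qed.

(** The spare cosine with free [a'] and [b'] makes the induction work: the product-to-sum formula
    absorbs one factor of the power into it. *)
Lemma log_cvg_cosX (R : realType) (x : nat -> R) (a b : R) (m : nat) :
  exp_log_cvg x -> forall a' b',
  log_cvg x (fun t => cos (a * t + b) ^+ m * cos (a' * t + b')).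
Proof.
move=> hx; elim: m => [|m IH] a' b'.
  have := log_cvg_cos a' b' hx; congr log_cvg; apply/funext => t.
  by rewrite expr0 mul1r.
have := log_cvg_linear 2^-1 2^-1 (IH (a + a') (b + b')) (IH (a - a') (b - b')).
congr log_cvg; apply/funext => t.
have -> : (a + a') * t + (b + b') = (a * t + b) + (a' * t + b') by ring.
have -> : (a - a') * t + (b - b') = (a * t + b) - (a' * t + b') by ring.
move: (a * t + b) (a' * t + b') => u v.
by rewrite cosB cosD exprS; field.
Qed.


(** * Bernstein approximation and bounded continuous functions *)

(* [bern g n y] is the expectation of [g] at a binomial variable with
   parameters [n] and [y], computed by conditioning on one trial. *)
Fixpoint bern (R : realType) (g : nat -> R) (n : nat) (y : R) : R :=
  if n is n'.+1 then y * bern (fun k => g k.+1) n' y + (1 - y) * bern g n' y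
  else g 0%N.

Lemma ler_bern (R : realType) (f g : nat -> R) (n : nat) (y : R) :
  0 <= y <= 1 -> (forall k, f k <= g k) -> bern f n y <= bern g n y.
Proof.
move=> /andP[y0 y1]; elim: n f g => [|n IH] f g fg //=.
by apply: lerD; apply: ler_wpM2l; rewrite ?subr_ge0//; apply: IH => k.
Qed.

Lemma bern_linear (R : realType) (f g : nat -> R) (a b : R) (n : nat) (y : R) :
  bern (fun k => a * f k + b * g k) n y = a * bern f n y + b * bern g n y.
Proof. by elim: n f g => [|n IH] f g //=; rewrite !IH; ring. Qed.

Lemma bern_cst (R : realType) (c : R) (n : nat) (y : R) :
  bern (fun=> c) n y = c.
Proof. by elim: n => [|n IH] //=; rewrite !IH; ring. Qed.

(** Binomial variance plus squared bias. The centre [c] is arbitrary because a success in the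
    conditioned trial shifts it to [c - 1]. *)
Lemma bern_sqr (R : realType) (c : R) (n : nat) (y : R) :
  bern (fun k => (k%:R - c) ^+ 2) n y =
  n%:R * y * (1 - y) + (n%:R * y - c) ^+ 2.
Proof.
elim: n c => [|n IH] c /=; first by ring.
have -> : (fun k : nat => (k.+1%:R - c) ^+ 2) = (fun k : nat => (k%:R - (c - 1)) ^+ 2).
  by apply/funext => k; rewrite -natr1; ring.
by rewrite !IH -natr1; ring.
Qed.

(** Compactness of the unit interval yields [d]. The point [u] may leave the interval, because it is
    later [k / n] for an arbitrary natural [k]. *)
Lemma uniform_continuity_unit (R : realType) (f : R -> R) (e : R) :
  continuous f -> 0 < e -> exists2 d, 0 < d &
    forall y u, 0 <= y <= 1 -> `|u - y| < d -> `|f u - f y| <= e.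
Proof.
move=> cf e0.
pose P (d y : R) := forall u, `|u - y| < d -> `|f u - f y| <= e.
have /compact_near_coveringP nc := @segment_compact R 0 1.
have [d /= d0 hd] : \forall d \near (0 : R)^'+, `[0, 1]%classic `<=` P d.
  apply: nc => y _.
  have e20 : 0 < e / 2 by rewrite divr_gt0.
  have /cvgrPdist_le/(_ _ e20)[r /= r0 hr] := cf y.
  have r20 : 0 < r / 2 by rewrite divr_gt0.
  (* Half of the radius allows for moving the centre from [y] to [z], the other half for moving from
     [z] to [u]. *)
  exists (ball y (r / 2), [set d : R | 0 < d < r / 2]) => /=.
    split; first exact: nbhsx_ballx.
    near=> d; apply/andP; split; near: d; first exact: nbhs_right_gt.
    exact: nbhs_right_lt.
  move=> [z d] /= [yz /andP[d0 dr]] u ud.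
  have yz' : `|y - z| < r / 2 by exact: yz.
  have h1 : `|f y - f z| <= e / 2.
    by apply: hr; apply: lt_le_trans yz' _; lra.
  have h2 : `|f y - f u| <= e / 2.
    apply: hr => /=; have -> : y - u = (y - z) - (u - z) by ring.
    apply: le_lt_trans (ler_normB _ _) _.
    have -> : r = r / 2 + r / 2 by field.
    by apply: ltrD => //; exact: lt_trans dr.
  have -> : f u - f z = (f y - f z) - (f y - f u) by ring.
  apply: le_trans (ler_normB _ _) _.
  have -> : e = e / 2 + e / 2 by field.
  exact: lerD.
exists (d / 2); first by rewrite divr_gt0.
move=> y u y01 uy; apply: (hd (d / 2)) => //=.
- by rewrite sub0r normrN gtr0_norm ?divr_gt0//; lra.
- by rewrite divr_gt0.
Unshelve. all: by end_near. Qed.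

(** Chebyshev's argument: at sample points within [d] of [y] the error is at most [e / 2], elsewhere
    [2 * M] is at most [C] times the squared distance, whose binomial mean is [y * (1 - y) / n]. *)
Lemma bernstein_approx (R : realType) (f : R -> R) (M e : R) :
  continuous f -> (forall y, `|f y| <= M) -> 0 < e ->
  exists n, forall y, 0 <= y <= 1 ->
    `|f y - bern (fun k => f (k%:R / n%:R)) n y| <= e.
Proof.
move=> cf fM e0; have e20 : 0 < e / 2 by rewrite divr_gt0.
have [d d0 hd] := uniform_continuity_unit cf e20.
have M0 : 0 <= M by apply: le_trans (fM 0).
pose C := 2 * M / d ^+ 2.
have C0 : 0 <= C by apply: divr_ge0; [exact: mulr_ge0|exact: sqr_ge0].
pose n := (Num.bound (C / (e / 2))).+1; pose N : R := n%:R.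
have N0 : 0 < N by rewrite ltr0n.
have CN : C / N <= e / 2.
  rewrite ler_pdivrMr// mulrC -ler_pdivrMr//.
  have := archi_boundP (divr_ge0 C0 (ltW e20)).
  by move=> /ltW h; apply: le_trans h _; rewrite ler_nat.
exists n => y y01; have [y0 y1] := andP y01; rewrite -/N.
have key k : `|f (k%:R / N) - f y| <= e / 2 * 1 + C / N ^+ 2 * (k%:R - N * y) ^+ 2.
  have -> : C / N ^+ 2 * (k%:R - N * y) ^+ 2 = C * (k%:R / N - y) ^+ 2.
    by field; rewrite gt_eqF.
  rewrite mulr1; set u := k%:R / N.
  have [ud|ud] := ltP `|u - y| d.
    by apply: le_trans (hd y u y01 ud) _; rewrite lerDl mulr_ge0 ?sqr_ge0.
  apply: (@le_trans _ _ (2 * M)).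
    by apply: le_trans (ler_normB _ _) _; rewrite mulr_natl mulr2n lerD.
  apply: (@le_trans _ _ (C * (u - y) ^+ 2)); last by rewrite lerDr ltW.
  rewrite -(real_normK (num_real (u - y))) /C mulrAC ler_pdivlMr ?exprn_gt0//.
  by rewrite ler_wpM2l ?mulr_ge0// lerXn2r ?nnegrE// ltW.
have ub : bern (fun k => e / 2 * 1 + C / N ^+ 2 * (k%:R - N * y) ^+ 2) n y <= e.
  rewrite bern_linear bern_cst bern_sqr -/N subrr expr0n addr0 mulr1.
  have -> : C / N ^+ 2 * (N * y * (1 - y)) = C / N * (y * (1 - y)).
    by field; rewrite gt_eqF.
  have : C / N * (y * (1 - y)) <= e / 2 * 1.
    apply: ler_pM => //; last by nra.
      by rewrite divr_ge0// ltW.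
    by rewrite mulr_ge0// subr_ge0.
  by lra.
have E : bern (fun k => f (k%:R / N)) n y - f y =
    bern (fun k => 1 * f (k%:R / N) + -1 * f y) n y.
  by rewrite bern_linear bern_cst; ring.
have E' : f y - bern (fun k => f (k%:R / N)) n y =
    bern (fun k => -1 * f (k%:R / N) + 1 * f y) n y.
  by rewrite bern_linear bern_cst; ring.
rewrite ler_norml lerNl opprB E E'.
by apply/andP; split; apply: le_trans ub; apply: ler_bern => // k;
  have := key k; rewrite ler_norml => /andP[]; lra.
Qed.

Lemma bern_bound (R : realType) (f : nat -> R) (M : R) (n : nat) (y : R) :
  0 <= y <= 1 -> (forall k, `|f k| <= M) -> `|bern f n y| <= M.
Proof.
move=> y01 fM; rewrite ler_norml -{1}[- M](bern_cst _ n y) -{2}[M](bern_cst _ n y).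
by apply/andP; split; apply: ler_bern => // k; have := fM k;
  rewrite ler_norml => /andP[].
Qed.

(** The extra power [m] absorbs the weights [(1 + cos) / 2] and [(1 - cos) / 2] of the recursion,
    each of which raises it by at most one. *)
Lemma log_cvg_bern_cos (R : realType) (x : nat -> R) (a b : R) (n : nat) :
  exp_log_cvg x -> forall g m,
  log_cvg x (fun t => cos (a * t + b) ^+ m * bern g n ((1 + cos (a * t + b)) / 2)).
Proof.
move=> hx; elim: n => [|n IH] g m.
  have h := log_cvg_cosX a b m hx 0 0.
  have := log_cvg_linear (g 0%N) 0 h h; congr log_cvg; apply/funext => t /=.
  by rewrite mul0r add0r cos0; ring.
have := log_cvg_linear 1 1
  (log_cvg_linear 2^-1 2^-1 (IH (fun k => g k.+1) m) (IH (fun k => g k.+1) m.+1))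
  (log_cvg_linear 2^-1 (- 2^-1) (IH g m) (IH g m.+1)).
congr log_cvg; apply/funext => t /=; rewrite exprS.
by field.
Qed.

(** On [[-K, K]] the map [sin (a * t)] is invertible, so [f] there is a continuous function of it
    and has a Bernstein approximation. Outside, the error stays below [2 * M], which the weight
    dominates. *)
Lemma log_cvg_bounded_continuous (R : realType) (x : nat -> R) (f : R -> R)
    (M : R) : exp_log_cvg x -> continuous f -> (forall t, `|f t| <= M) ->
  log_cvg x f.
Proof.
move=> hx cf fM; apply: (@log_cvg_closed _ _ _ 1) => // e e0.
have M0 : 0 <= M by apply: le_trans (fM 0).
pose K := 2 * M / e + 1; have K0 : 0 < K.
  by apply: ltr_wpDl => //; apply: divr_ge0; [exact: mulr_ge0|exact: ltW].
have KM : 2 * M <= e * K.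
  have -> : e * K = 2 * M + e by rewrite /K; field; rewrite gt_eqF.
  by rewrite lerDl ltW.
(* Keeps [a * t] in [[-1/2, 1/2]], strictly inside the interval where [sin] is inverted by
   [asin]. *)
pose a := (2 * K)^-1; have a0 : 0 < a by rewrite invr_gt0 mulr_gt0.
have pi2 : 1 <= pi / 2 :> R by rewrite ler_pdivlMr// mul1r pi_ge2.
pose s : R := sin 2^-1.
have in_pi (z : R) : `|z| <= 2^-1 -> z \in `[- (pi / 2), pi / 2].
  by rewrite ler_norml in_itv/= => /andP[? ?]; apply/andP; split; lra.
have s1 : s < 1.
  by rewrite -sin_pihalf /s ltr_sin ?in_itv/=; lra.
have sin_s z : `|z| <= 2^-1 -> - s <= sin z <= s.
  move=> z2; rewrite /s -sinN !(leNgt, ltr_sin) ?in_pi// ?normrN ?ger0_norm//.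
  by move: z2; rewrite ler_norml !leNgt.
(* Clamping to [[-s, s]] keeps the argument of [asin] off its endpoints, so that [F] is continuous
   on the whole line. *)
pose clamp (z : R) := Num.max (- s) (Num.min s z).
have clampE z : - s <= z <= s -> clamp z = z.
  by move=> /andP[h1 h2]; rewrite /clamp (min_idPr h2) (max_idPr h1).
have s0 : - s <= s.
  have := sin_s 0; rewrite normr0 invr_ge0 ler0n sin0 => /(_ isT) /andP[? ?].
  by lra.
have clamp1 z : -1 < clamp z < 1.
  rewrite /clamp lt_max gt_max gt_min s1 ltrN2 s1 /=.
  by rewrite (le_lt_trans s0 s1).
have cclamp : continuous clamp.
  move=> z; apply: (@continuous_max _ _ (fun=> - s) (fun z => Num.min s z)).
    exact: cvg_cst.
  by apply: (@continuous_min _ _ (fun=> s) id); [exact: cvg_cst|exact: cvg_id].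
clearbody clamp.
pose F y := f (a^-1 * asin (clamp (2 * y - 1))).
have cF : continuous F.
  have c1 : continuous (fun y : R => clamp (2 * y - 1)).
    move=> y; apply: continuous_comp; last exact: cclamp.
    by apply: cvgB; [apply: cvgMr; exact: cvg_id|exact: cvg_cst].
  have c2 : continuous (fun y : R => asin (clamp (2 * y - 1))).
    by move=> y; apply: (continuous_comp (c1 y)); exact: continuous_asin.
  move=> y; apply: continuous_comp; last exact: cf.
  by apply: cvgMr; exact: c2.
have FM y : `|F y| <= M by exact: fM.
have [n hn] := bernstein_approx cF FM e0.
(* The shift by [pi / 2] turns the cosine into [sin (a * t)]. *)
pose Y t := (1 + cos (a * t + - (pi / 2))) / 2 : R.
have Y01 t : 0 <= Y t <= 1.
  have := cos_geN1 (a * t + - (pi / 2)); have := cos_le1 (a * t + - (pi / 2)).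
  by rewrite /Y; move: (cos _) => c c1 c2; apply/andP; split; lra.
exists (fun t => bern (fun k => F (k%:R / n%:R)) n (Y t)).
  have := log_cvg_bern_cos a (- (pi / 2)) n hx (fun k => F (k%:R / n%:R)) 0.
  by congr log_cvg; apply/funext => t; rewrite expr0 mul1r.
move=> t; rewrite mul1r.
have [tK|tK] := leP `|t| K.
  have at2 : `|a * t| <= 2^-1.
    rewrite normrM (gtr0_norm a0) /a invfM -mulrA ler_piMr ?invr_ge0//.
    by rewrite mulrC ler_pdivrMr// mul1r.
  have -> : f t = F (Y t).
    rewrite /F /Y cosBpihalf.
    have -> : 2 * ((1 + sin (a * t)) / 2) - 1 = sin (a * t) by field.
    rewrite clampE ?sin_s// sinK ?in_pi//.
    by rewrite mulrA mulVf ?mul1r// gt_eqF.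
  apply: le_trans (hn _ (Y01 t)) _.
  by rewrite ler_peMr ?(ltW e0)// -expR0 ler_expR.
apply: (@le_trans _ _ (2 * M)).
  apply: le_trans (ler_normB _ _) _; rewrite mulr_natl mulr2n lerD//.
  exact: bern_bound.
apply: le_trans KM _; rewrite ler_pM2l//.
apply: le_trans (ltW tK) _; apply: le_trans (expR_ge1Dx _).
by rewrite lerDr.
Qed.


(** * Almost sure convergence *)

(** The sharper bound [2 - 1 / (n + 1)] on the sum of [n + 1] terms passes through the induction by
    telescoping. *)
Lemma sum_inv_sqr_le2 (R : realType) (n : nat) :
  \sum_(0 <= m < n) ((m.+1 ^ 2)%:R^-1 : R) <= 2.
Proof.
apply: (@le_trans _ _ (\sum_(0 <= m < n.+1) ((m.+1 ^ 2)%:R^-1))).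
  by rewrite big_nat_recr//= lerDl invr_ge0.
apply: (@le_trans _ _ (2 - n.+1%:R^-1)); last by rewrite gerBl invr_ge0.
elim: n => [|n IH].
  by rewrite big_nat1 exp1n invr1; lra.
rewrite big_nat_recr//=; apply: le_trans (lerD IH (lexx _)) _.
set N : R := n.+1%:R; have N0 : 0 < N by rewrite ltr0n.
have -> : n.+2%:R = N + 1 by rewrite natr1.
have -> : (n.+2 ^ 2)%:R = (N + 1) ^+ 2 by rewrite natrX natr1.
rewrite -subr_ge0.
have -> : 2 - (N + 1)^-1 - (2 - N^-1 + (N + 1) ^- 2) = (N * (N + 1) ^+ 2)^-1.
  by field; rewrite !gt_eqF// addr_gt0.
by rewrite invr_ge0 mulr_ge0 ?sqr_ge0// ltW.
Qed.

(** The series of the [Q m] has finite expectation, so it converges almost everywhere and its terms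
    tend to 0. *)
Lemma ae_cvg0_of_summable d (T : measurableType d) (R : realType)
    (P : probability T R) (Q : nat -> T -> R) (C : R) :
  (forall m, measurable_fun setT (Q m)) -> (forall m w, 0 <= Q m w) ->
  (forall m, (\int[P]_w (Q m w)%:E <= (C / (m.+1 ^ 2)%:R)%:E)%E) ->
  {ae P, forall w, (fun m => Q m w) @ \oo --> (0 : R)}.
Proof.
move=> mQ Q0 QC.
have C0 : 0 <= C.
  have := QC 0%N; rewrite exp1n divr1 -lee_fin; apply: le_trans.
  by apply: integral_ge0 => w _; rewrite lee_fin.
pose S w := (\sum_(0 <= i <oo) (Q i w)%:E)%E.
have S0 w : (0 <= S w)%E by apply: nneseries_ge0 => n _ _; rewrite lee_fin.
have mS : measurable_fun setT S.
  have := @ge0_emeasurable_sum _ _ _ setT (fun k w => (Q k w)%:E) xpredT.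
  by apply => // k *; [rewrite lee_fin|exact/measurable_EFinP].
have ES : (\int[P]_w S w <= (C * 2)%:E)%E.
  rewrite integral_nneseries//; last 2 first.
  - by move=> n; exact/measurable_EFinP.
  - by move=> n w _; rewrite lee_fin.
  apply: lime_le.
    by apply: is_cvg_nneseries => n _ _; apply: integral_ge0 => w _; rewrite lee_fin.
  apply: nearW => n.
  apply: (@le_trans _ _ (\sum_(0 <= m < n) (C / (m.+1 ^ 2)%:R)%:E)%E).
    by apply: lee_sum => m _; exact: QC.
  by rewrite sumEFin lee_fin -mulr_sumr ler_wpM2l// sum_inv_sqr_le2.
have iS : P.-integrable setT S.
  apply/integrableP; split => //.
  by under eq_integral do rewrite gee0_abs//; rewrite (le_lt_trans ES)// ltry.
apply: filterS (integrable_ae measurableT iS) => w /(_ I) Sw.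
apply: cvg_series_cvg_0; apply: nondecreasing_is_cvgn.
  by apply/nondecreasing_series => k _ _.
exists (fine (S w)) => _ [n _ <-].
rewrite -lee_fin fineK// /series/= -sumEFin.
by apply: nneseries_lim_ge => k _ _; rewrite lee_fin.
Qed.

(** Integrability travels with the value, so that expanded squares can be integrated term by
    term. *)
Definition has_integral d (T : measurableType d) (R : realType)
    (P : probability T R) (f : T -> R) (v : R) : Prop :=
  P.-integrable setT (EFin \o f) /\ (\int[P]_w (f w)%:E = v%:E)%E.

Lemma has_integral_cst d (T : measurableType d) (R : realType)
    (P : probability T R) (c : R) : has_integral P (fun=> c) c.
Proof.
split; first exact: finite_measure_integrable_cst.
by rewrite integral_cst//= probability_setT mule1.
Qed.

Lemma has_integralD d (T : measurableType d) (R : realType)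
    (P : probability T R) (f g : T -> R) (u v : R) :
  has_integral P f u -> has_integral P g v ->
  has_integral P (fun w => f w + g w) (u + v).
Proof.
move=> [f1 f2] [g1 g2]; split; first exact: (integrableD measurableT f1 g1).
by rewrite integralD_EFin// f2 g2.
Qed.

Lemma has_integralZ d (T : measurableType d) (R : realType)
    (P : probability T R) (f : T -> R) (c u : R) :
  has_integral P f u -> has_integral P (fun w => c * f w) (c * u).
Proof.
move=> [f1 f2]; split; first exact: (integrableZl measurableT c f1).
by under eq_integral do rewrite EFinM; rewrite integralZl// f2.
Qed.

Lemma has_integral_sum d (T : measurableType d) (R : realType)
    (P : probability T R) (f : nat -> T -> R) (v : nat -> R) (n : nat) :
  (forall k, (0 < k)%N -> has_integral P (f k) (v k)) ->
  has_integral P (fun w => \sum_(1 <= k < n.+1) f k w)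
    (\sum_(1 <= k < n.+1) v k).
Proof.
move=> h; elim: n => [|n IH].
  under [X in has_integral _ X _]eq_fun do rewrite big_geq//.
  by rewrite big_geq//; exact: has_integral_cst.
under [X in has_integral _ X _]eq_fun do rewrite big_nat_recr//.
by rewrite big_nat_recr//=; apply: has_integralD => //; exact: h.
Qed.

Lemma eq_has_integral d (T : measurableType d) (R : realType)
    (P : probability T R) (f g : T -> R) (u v : R) :
  f =1 g -> u = v -> has_integral P f u -> has_integral P g v.
Proof. by move=> /funext -> ->. Qed.

(* The second moments of the centred means are summable along [2 ^ (m ^ 2)]. *)
Lemma ae_log_mean_cvg d (T : measurableType d) (R : realType)
    (P : probability T R) (a : nat -> T -> R) (l b K : R)
    (c : nat -> nat -> R) :
  0 < b <= 1 -> 0 <= K -> (forall k w, 0 <= a k w) ->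
  (forall k, (0 < k)%N -> has_integral P (a k) l) ->
  (forall j k, (0 < j)%N -> (0 < k)%N ->
     has_integral P (fun w => a j w * a k w) (l ^+ 2 + c j k)) ->
  (forall j k, c j k = c k j) ->
  (forall j k, (0 < j <= k)%N -> c j k <= K * (j%:R / k%:R) `^ b) ->
  {ae P, forall w, log_mean (fun k => a k w) @ \oo --> l}.
Proof.
move=> b01 K0 a0 Ea Eaa cC cK; have b0 : 0 < b by case/andP: b01.
pose D n w := \sum_(1 <= k < n.+1) k%:R^-1 * (a k w - l).
pose V n := \sum_(1 <= j < n.+1) \sum_(1 <= k < n.+1) c j k / (j%:R * k%:R).
have ED n : has_integral P (fun w => D n w ^+ 2) (V n).
  have h j k : (0 < j)%N -> (0 < k)%N -> has_integral P
      (fun w => (j%:R^-1 * (a j w - l)) * (k%:R^-1 * (a k w - l)))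
      (c j k / (j%:R * k%:R)).
    move=> j0 k0.
    have := has_integralZ ((j%:R * k%:R)^-1) (has_integralD (Eaa j k j0 k0)
      (has_integralD (has_integralZ (- l) (Ea j j0))
      (has_integralD (has_integralZ (- l) (Ea k k0)) (has_integral_cst P (l ^+ 2))))).
    apply: eq_has_integral; last by field; rewrite !gt_eqF ?ltr0n.
    by move=> w; field; rewrite !gt_eqF ?ltr0n.
  have := has_integral_sum n (fun j j0 => has_integral_sum n (fun k k0 => h j k j0 k0)).
  apply: eq_has_integral => // w.
  rewrite expr2 /D mulr_suml; apply: eq_bigr => j _.
  by rewrite mulr_sumr.
(* The index [m.+1] avoids a zero normalization at the first term. *)
pose Q m w := ((m.+1 ^ 2)%:R^-1 * D (2 ^ (m.+1 ^ 2))%N w) ^+ 2.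
have EQ m : has_integral P (Q m) ((m.+1 ^ 2)%:R^-1 ^+ 2 * V (2 ^ (m.+1 ^ 2))%N).
  have := has_integralZ ((m.+1 ^ 2)%:R^-1 ^+ 2) (ED (2 ^ (m.+1 ^ 2))%N).
  by apply: eq_has_integral => // w; rewrite /Q exprMn.
have aeQ : {ae P, forall w, (fun m => Q m w) @ \oo --> (0 : R)}.
  (* The kernel estimate gives [2 * K / b] times a harmonic sum, and that sum is at most
     [1 + p * ln 2 <= 3 * p]. *)
  apply: (@ae_cvg0_of_summable _ _ _ _ _ (6 * K / b)).
  - by move=> m; have [/integrableP[/measurable_EFinP]] := EQ m.
  - by move=> m w; exact: sqr_ge0.
  - move=> m; have [_ ->] := EQ m; rewrite lee_fin.
    set N := (2 ^ _)%N; set p : R := (m.+1 ^ 2)%:R.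
    have p1 : 1 <= p by rewrite ler1n expn_gt0.
    have p0 : 0 < p by exact: lt_le_trans p1.
    have VN : V N <= 6 * K / b * p.
      apply: le_trans (sum_kernel_le N b01 K0 cC cK) _.
      have /andP[_ hN] := harmonic_sum_bounds R N.
      have -> : 6 * K / b * p = 2 * K / b * (3 * p) by ring.
      apply: ler_wpM2l; first by rewrite divr_ge0 ?mulr_ge0// ltW.
      apply: le_trans hN _; rewrite /N ln_2sqr -/p.
      have : ln (2 : R) < 2 by exact: ln_sublinear.
      by have := ler_wpM2l (ltW p0); nra.
    have -> : 6 * K / b / p = p^-1 ^+ 2 * (6 * K / b * p).
      by field; rewrite !gt_eqF.
    by rewrite ler_wpM2l// sqr_ge0.
apply: filterS aeQ => w hQ; apply: log_mean_interpolation => //.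
rewrite -(cvg_shiftn 1); under eq_fun do rewrite addn1.
apply/cvgrPdist_lt => e e0.
have e20 : 0 < e ^+ 2 by rewrite exprn_gt0.
have /cvgrPdist_lt/(_ _ e20) := hQ; apply: filterS => m.
rewrite !sub0r !normrN /Q normrX ltr_pXn2r ?nnegrE ?(ltW e0)//.
Qed.


(** * Moments of fractional Brownian motion *)

Definition fbm_cov (R : realType) (H t s : R) : R :=
  (t `^ (2 * H) + s `^ (2 * H) - `|t - s| `^ (2 * H)) / 2.

Lemma fbm_covC (R : realType) (H t s : R) : fbm_cov H t s = fbm_cov H s t.
Proof. by rewrite /fbm_cov distrC [s `^ _ + _]addrC. Qed.

Lemma fbm_cov_diag (R : realType) (H t : R) : H != 0 -> 0 < t ->
  fbm_cov H t t = (t `^ H) ^+ 2.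
Proof.
move=> H0 t0; rewrite /fbm_cov subrr normr0 powR0 ?mulf_neq0//.
have -> : t `^ (2 * H) = (t `^ H) ^+ 2.
  by rewrite mulr_natl mulr2n powRD ?(gt_eqF t0) ?implybT.
by field.
Qed.

Lemma fBm_measurable d (T : measurableType d) (R : realType)
    (P : probability T R) (H : R) (B : R -> T -> R) (t : R) :
  is_fBm P H B -> 0 <= t -> measurable_fun setT (B t).
Proof.
move=> fB t0; case: fB => /(_ 1%N (fun=> t) (fun=> 1) (fun=> t0))[+ _] _ _ _.
by under eq_fun do rewrite big_ord1 mul1r.
Qed.

(** The diagonal covariances make the squares integrable, and these dominate the product. *)
Lemma fBm_has_integralM d (T : measurableType d) (R : realType)
    (P : probability T R) (H : R) (B : R -> T -> R) (t s : R) :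
  is_fBm P H B -> 0 <= t -> 0 <= s ->
  has_integral P (fun w => B t w * B s w) (fbm_cov H t s).
Proof.
move=> fB t0 s0.
have mt := fBm_measurable fB t0; have ms := fBm_measurable fB s0.
have E u v : 0 <= u -> 0 <= v ->
    (\int[P]_w (B u w * B v w)%:E = (fbm_cov H u v)%:E)%E.
  by move=> u0 v0; case: fB => _ _ /(_ u v u0 v0) + _; rewrite unlock.
have sq u : 0 <= u -> P.-integrable setT (EFin \o (fun w => B u w * B u w)).
  move=> u0; apply: ge0_integral_fin_integrable (E u u u0 u0).
    by apply: measurable_funM; exact: (fBm_measurable fB).
  by move=> w; rewrite -expr2 sqr_ge0.
split; last exact: E.
apply: (le_integrable measurableT _ _ (integrableD measurableT (sq t t0) (sq s s0))).
  by apply/measurable_EFinP; exact: measurable_funM.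
move=> w _ /=; rewrite lee_fin; apply: le_trans (ler_norm _).
by rewrite ler_norml; apply/andP; split; nra.
Qed.

Lemma fBm_has_integral d (T : measurableType d) (R : realType)
    (P : probability T R) (H : R) (B : R -> T -> R) (t : R) :
  is_fBm P H B -> 0 <= t -> has_integral P (B t) 0.
Proof.
move=> fB t0; split; last by case: fB => _ /(_ t t0) + _ _; rewrite unlock.
apply: sqr_integrable_integrable; first exact: (fBm_measurable fB).
by have [+ _] := fBm_has_integralM fB t0 t0; under eq_fun do rewrite -expr2.
Qed.

(** The combination is a centered Gaussian variable whose variance is the quadratic form in the
    exponent. *)
Lemma fBm_mgf d (T : measurableType d) (R : realType)
    (P : probability T R) (H : R) (B : R -> T -> R) (t s a b : R) :
  is_fBm P H B -> 0 <= t -> 0 <= s ->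
  has_integral P (fun w => expR (a * B t w + b * B s w))
    (expR ((a ^+ 2 * fbm_cov H t t + 2 * a * b * fbm_cov H t s +
      b ^+ 2 * fbm_cov H s s) / 2)).
Proof.
move=> fB t0 s0.
have gZ : is_gaussian_rv P (fun w => a * B t w + b * B s w).
  pose ts (i : 'I_2) := if i == 0 :> nat then t else s.
  pose ab (i : 'I_2) := if i == 0 :> nat then a else b.
  have -> : (fun w => a * B t w + b * B s w) =
      (fun w => \sum_(i < 2) ab i * B (ts i) w).
    by apply/funext => w; rewrite big_ord_recl big_ord1.
  by case: fB => g _ _ _; apply: g => i; rewrite /ts; case: ifP.
have [_ EZ] := has_integralD (has_integralZ a (fBm_has_integral fB t0))
  (has_integralZ b (fBm_has_integral fB s0)).
rewrite !mulr0 addr0 in EZ.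
have [_ EZ2] : has_integral P (fun w => (a * B t w + b * B s w) ^+ 2)
    (a ^+ 2 * fbm_cov H t t + 2 * a * b * fbm_cov H t s + b ^+ 2 * fbm_cov H s s).
  have := has_integralD (has_integralD
    (has_integralZ (a ^+ 2) (fBm_has_integralM fB t0 t0))
    (has_integralZ (2 * a * b) (fBm_has_integralM fB t0 s0)))
    (has_integralZ (b ^+ 2) (fBm_has_integralM fB s0 s0)).
  by apply: eq_has_integral => // w; ring.
have E := gaussian_mgf gZ EZ EZ2; split => //.
apply: ge0_integral_fin_integrable E => [|w]; last exact: expR_ge0.
by apply: measurableT_comp => //; case: gZ.
Qed.

Lemma fBm_ae_exp d (T : measurableType d) (R : realType)
    (P : probability T R) (H : R) (B : R -> T -> R) (c : R) :
  0 < H < 1 -> is_fBm P H B ->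
  {ae P, forall w, log_mean (fun k => expR (c * (B k%:R w / k%:R `^ H))) @ \oo -->
    expR (c ^+ 2 / 2)}.
Proof.
move=> H01 fB; have [H0 H1] := andP H01.
have N0 k : (0 < k)%N -> (0 : R) < k%:R by rewrite ltr0n.
have NH k : (0 < k)%N -> (0 : R) < k%:R `^ H by move=> /N0; exact: powR_gt0.
(* The correlation of the normalized variables; the covariance of their exponentials is then
   [l ^+ 2 * (expR (c ^+ 2 * rho j k) - 1)]. *)
pose rho (j k : nat) : R := fbm_cov H j%:R k%:R / (j%:R `^ H * k%:R `^ H).
pose l := expR (c ^+ 2 / 2).
(* Collects the constants of [expR u - 1 <= u * expR u] at [u = c ^+ 2 * rho j k], with
   [rho j k <= 2 * x] in the first factor and [rho j k <= 2] in the exponent. *)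
pose K := l ^+ 2 * (c ^+ 2 * 2 * expR (c ^+ 2 * 2)).
pose b := Num.min H (1 - H).
have b0 : 0 < b by rewrite lt_min H0 subr_gt0.
have bH : b <= H by rewrite ge_min lexx.
have b1H : b <= 1 - H by rewrite ge_min lexx orbT.
have c20 : 0 <= c ^+ 2 by exact: sqr_ge0.
apply: (@ae_log_mean_cvg _ _ _ _ _ _ b K
  (fun j k => l ^+ 2 * (expR (c ^+ 2 * rho j k) - 1))).
- by rewrite b0 (le_trans bH) ?ltW.
- by rewrite mulr_ge0 ?sqr_ge0// mulr_ge0 ?expR_ge0// mulr_ge0.
- by move=> k w; exact: expR_ge0.
- move=> k k0; have kH := NH k k0.
  have := fBm_mgf (c / k%:R `^ H) 0 fB (ler0n R k) (ler0n R k).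
  apply: eq_has_integral => [w|]; first by congr expR; field; rewrite gt_eqF.
  rewrite fbm_cov_diag ?N0 ?gt_eqF// /l.
  by congr expR; field; rewrite gt_eqF.
- move=> j k j0 k0; have jH := NH j j0; have kH := NH k k0.
  have := fBm_mgf (c / j%:R `^ H) (c / k%:R `^ H) fB (ler0n R j) (ler0n R k).
  apply: eq_has_integral => [w|].
    by rewrite -expRD; congr expR; field; rewrite !gt_eqF.
  rewrite !fbm_cov_diag ?N0 ?gt_eqF// mulrBr mulr1 [RHS]addrC subrK.
  rewrite /l -expRM_natl -expRD /rho.
  by congr expR; field; rewrite !gt_eqF.
- move=> j k; rewrite /rho fbm_covC.
  by rewrite [X in _ / X]mulrC.
- move=> j k /andP[j0 jk]; have k0 : (0 < k)%N by exact: leq_trans jk.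
  have jk' : 0 < (j%:R : R) <= k%:R by rewrite N0//= ler_nat.
  have [cov0] := andP (fbm_cov_bound H01 bH b1H jk').
  set x := (j%:R / k%:R) `^ b => covx.
  have rhoE : rho j k = fbm_cov H k%:R j%:R / (k%:R `^ H * j%:R `^ H).
    by rewrite /rho fbm_covC [X in _ / X]mulrC.
  have D0 : 0 < (k%:R `^ H * j%:R `^ H : R) by rewrite mulr_gt0 ?NH.
  have rho0 : 0 <= rho j k by rewrite rhoE divr_ge0// ltW.
  have rhox : rho j k <= 2 * x by rewrite rhoE ler_pdivrMr.
  have x0 : 0 <= x by exact: powR_ge0.
  have x1 : x <= 1.
    rewrite /x -[leRHS](powRr0 (j%:R / k%:R)) ger_powR//; last exact: ltW.
    by rewrite divr_gt0 ?N0//= ler_pdivrMr ?N0// mul1r ler_nat.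
  rewrite /K -mulrA ler_wpM2l ?sqr_ge0//.
  have u0 : 0 <= c ^+ 2 * rho j k by exact: mulr_ge0.
  apply: (@le_trans _ _ (c ^+ 2 * rho j k * expR (c ^+ 2 * rho j k))).
    have := expR_ge1Dx (- (c ^+ 2 * rho j k)).
    rewrite -(ler_pM2l (expR_gt0 (c ^+ 2 * rho j k))) expRxMexpNx_1.
    by lra.
  apply: (@le_trans _ _ (c ^+ 2 * (2 * x) * expR (c ^+ 2 * 2))).
    apply: ler_pM; rewrite ?expR_ge0//.
      exact: ler_wpM2l.
    by rewrite ler_expR; apply: ler_wpM2l => //; lra.
  by rewrite le_eqVlt; apply/orP; left; apply/eqP; ring.
Qed.

Unset Implicit Arguments.

Theorem mainTheorem6 (d : measure_display) (T : measurableType d)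
  (R : realType) (P : probability T R) (H : R) (B : R -> T -> R) :
  0 < H < 1 -> is_fBm P H B ->
  {ae P, forall w, forall phi : R -> R,
     continuous phi -> (exists M : R, forall x, `|phi x| <= M) ->
     (fun n : nat => ((ln (n%:R : R))^-1 *
        \sum_(1 <= k < n.+1) (k%:R)^-1 * phi (B k%:R w / (k%:R `^ H)))%:E)
       @ \oo --> (\int[normal_prob (0 : R) 1]_x (phi x)%:E)%E}.
Proof.
move=> H01 fB.
(* Enumerating the rationals by [unpickle] leaves a countable union of null sets; codes of no
   rational default to [q = 0]. *)
have : {ae P, forall w, forall n : nat,
    log_mean (fun k => expR (ratr (odflt 0 (unpickle n : option rat)) *
      (B k%:R w / k%:R `^ H))) @ \oo -->
    expR ((ratr (odflt 0 (unpickle n : option rat)) : R) ^+ 2 / 2)}.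
  by apply: ae_foralln => n; exact: fBm_ae_exp.
(* From here the path is fixed and the argument deterministic, so one null set serves every
   [phi]. *)
apply: filterS => w hw phi cphi [M phiM].
have hx : exp_log_cvg (fun k => B k%:R w / k%:R `^ H).
  by move=> q; have := hw (pickle q); rewrite pickleK.
have [_ _ lim] := log_cvg_bounded_continuous hx cphi phiM.
have iphi := log_cvg_integrable (log_cvg_bounded_continuous hx cphi phiM).
rewrite -[X in _ --> X]fineK; last exact: integrable_fin_num iphi.
by apply: cvg_EFin; [exact: nearW|exact: lim].
Qed.
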